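(* $\mathsf{RCA}_0^{\ast}$ proves the following: for every $f\colon\mathbb{N}\to\mathbb{N}$ and every $c\in\mathbb{N}$, the statements $\mathrm{MDL}^f_c$ and $\mathrm{WPH}^f_c$ are equivalent.
   Context: $\mathsf{RCA}_0^{\ast}$ is the subsystem of second order arithmetic, in the usual language augmented by a binary function symbol $\exp$ (written $m^n$), whose axioms are: the basic axioms of second order arithmetic (the usual quantifier-free axioms for $0,1,+,\cdot,<$); the exponentiation axioms $m^0=1$, $m^{n+1}=m\cdot m^n$; the induction scheme for all $\Sigma^0_0$ formulas (possibly containing $\exp$); and the comprehension scheme for all $\Delta^0_1$ formulas (possibly containing $\exp$). $\mathbb{N}$ is the set of nonnegative integers, and $c\in\mathbb{N}$ is identified with $\{0,\dots,c-1\}$. For $a,R\in\mathbb{N}$, $[a,R]=\{n\in\mathbb{N}:a\le n\le R\}$ and $[a,R]^2=\{(n,m)\in\mathbb{N}^2:a\le n<m\le R\}$. For a coloring $C\colon[a,R]^2\to c$, a set $H=\{h_0<h_1<\cdots\}\subseteq[a,R]$ is $C$-weakly homogeneous if $C(h_i,h_{i+1})=C(h_{i+1},h_{i+2})$ for all $h_i,h_{i+1},h_{i+2}\in H$. $\mathrm{WPH}^f_c(a,R)$: for every coloring $C\colon[a,R]^2\to c$ there is a (nonempty) $C$-weakly homogeneous set $H\subseteq[a,R]$ with $|H|>f(\min H)$. $\mathrm{WPH}^f_c$: for every $a$ there exists $R$ such that $\mathrm{WPH}^f_c(a,R)$ holds. For $\overline{m},\overline{n}\in\mathbb{N}^c$,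 $\overline{m}\le\overline{n}$ means $m_k\le n_k$ for all $k<c$, and $|\overline{m}|_\infty=\max_{k<c}m_k$ (with value $0$ if $c=0$). $\mathrm{MDL}^f_c(a,D)$: for every sequence $\overline{m}_0,\dots,\overline{m}_D\in\mathbb{N}^c$ with $|\overline{m}_i|_\infty<f(a+i)$ for all $i\le D$ there exist $i<j\le D$ with $\overline{m}_i\le\overline{m}_j$. $\mathrm{MDL}^f_c$: for every $a$ there exists $D$ such that $\mathrm{MDL}^f_c(a,D)$ holds. *)

(* Defs.v *)
From Stdlib Require Import List.
Import ListNotations.

(* Two-sorted de Bruijn syntax: number variables and set variables are indexed
   independently, [AllN] binding number variable 0 and [AllS] set variable 0. *)
Inductive term : Type :=
| Var (n : nat)
| Zero
| One
| Add (t s : term)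
| Mul (t s : term)
| Exp (t s : term).

Inductive form : Type :=
| Eq (t s : term)
| Lt (t s : term)
| Mem (t : term) (X : nat)
| Bot
| Imp (p q : form)
| AllN (p : form)
| AllS (p : form).

(* The logic is classical, so the other connectives are abbreviations. *)
Definition Not (p : form) : form := Imp p Bot.
Definition And (p q : form) : form := Not (Imp p (Not q)).
Definition Or (p q : form) : form := Imp (Not p) q.
Definition Iff (p q : form) : form := And (Imp p q) (Imp q p).
Definition ExN (p : form) : form := Not (AllN (Not p)).
Definition ExS (p : form) : form := Not (AllS (Not p)).

Fixpoint subst_term (s : nat -> term) (t : term) : term :=
  match t with
  | Var n => s n
  | Zero => Zero
  | One => One
  | Add t u => Add (subst_term s t) (subst_term s u)
  | Mul t u => Mul (subst_term s t) (subst_term s u)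
  | Exp t u => Exp (subst_term s t) (subst_term s u)
  end.

Definition shift_term : term -> term := subst_term (fun n => Var (S n)).

Definition up_num (s : nat -> term) (n : nat) : term :=
  match n with 0 => Var 0 | S k => shift_term (s k) end.

Definition up_set (r : nat -> nat) (n : nat) : nat :=
  match n with 0 => 0 | S k => S (r k) end.

(* Set terms are variables, so a substitution is a renaming on the set sort. *)
Fixpoint subst (s : nat -> term) (r : nat -> nat) (p : form) : form :=
  match p with
  | Eq t u => Eq (subst_term s t) (subst_term s u)
  | Lt t u => Lt (subst_term s t) (subst_term s u)
  | Mem t X => Mem (subst_term s t) (r X)
  | Bot => Bot
  | Imp p q => Imp (subst s r p) (subst s r q)
  | AllN p => AllN (subst (up_num s) r p)
  | AllS p => AllS (subst s (up_set r) p)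
  end.

Definition shift_num : form -> form := subst (fun n => Var (S n)) (fun X => X).
Definition shift_set : form -> form := subst Var S.

Definition inst_num (p : form) (t : term) : form :=
  subst (fun n => match n with 0 => t | S k => Var k end) (fun X => X) p.

Definition inst_set (p : form) (Y : nat) : form :=
  subst Var (fun X => match X with 0 => Y | S k => k end) p.

(* Classical natural deduction with equality on numbers.  The axioms in [T] are
   available under every context [G], whose formulas alone are shifted by the
   introduction rules for quantifiers; hence free variables of an axiom are
   implicitly universally quantified. *)
Inductive derives (T : form -> Prop) : list form -> form -> Prop :=
| d_axiom G p : T p -> derives T G p
| d_hyp G p : In p G -> derives T G p
| d_impI G p q : derives T (p :: G) q -> derives T G (Imp p q)
| d_impE G p q : derives T G (Imp p q) -> derives T G p -> derives T G q
| d_raa G p : derives T (Not p :: G) Bot -> derives T G p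
| d_allNI G p : derives T (map shift_num G) p -> derives T G (AllN p)
| d_allNE G p t : derives T G (AllN p) -> derives T G (inst_num p t)
| d_allSI G p : derives T (map shift_set G) p -> derives T G (AllS p)
| d_allSE G p Y : derives T G (AllS p) -> derives T G (inst_set p Y)
| d_refl G t : derives T G (Eq t t)
| d_leibniz G p t u :
    derives T G (Eq t u) -> derives T G (inst_num p t) ->
    derives T G (inst_num p u).

Definition proves (T : form -> Prop) (p : form) : Prop := derives T [] p.

(* Formulas are written in higher-order style: an expression computes its
   de Bruijn form from the number [d] of number binders and the number [e] of
   set binders above it.  A bound variable is stored as its level (the number
   of binders of its sort above its own), so that it may be used below further
   binders without explicit shifts. *)
Definition nexp : Type := nat -> term.
Definition sexp : Type := nat -> nat.
Definition fexp : Type := nat -> nat -> form.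

Definition level (l : nat) : nat -> nat := fun d => d - S l.

Definition all_num (p : nexp -> fexp) : fexp :=
  fun d e => AllN (p (fun d' => Var (level d d')) (S d) e).
Definition ex_num (p : nexp -> fexp) : fexp :=
  fun d e => ExN (p (fun d' => Var (level d d')) (S d) e).
Definition all_set (p : sexp -> fexp) : fexp :=
  fun d e => AllS (p (level e) d (S e)).
Definition ex_set (p : sexp -> fexp) : fexp :=
  fun d e => ExS (p (level e) d (S e)).

Definition zero : nexp := fun _ => Zero.
Definition one : nexp := fun _ => One.
Definition add (x y : nexp) : nexp := fun d => Add (x d) (y d).
Definition mul (x y : nexp) : nexp := fun d => Mul (x d) (y d).
Definition exp (x y : nexp) : nexp := fun d => Exp (x d) (y d).

Definition eq_num (x y : nexp) : fexp := fun d _ => Eq (x d) (y d).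
Definition lt_num (x y : nexp) : fexp := fun d _ => Lt (x d) (y d).
Definition mem (x : nexp) (X : sexp) : fexp := fun d e => Mem (x d) (X e).
Definition true_ : fexp := fun _ _ => Not Bot.
Definition not_ (p : fexp) : fexp := fun d e => Not (p d e).
Definition and_ (p q : fexp) : fexp := fun d e => And (p d e) (q d e).
Definition or_ (p q : fexp) : fexp := fun d e => Or (p d e) (q d e).
Definition imp_ (p q : fexp) : fexp := fun d e => Imp (p d e) (q d e).
Definition iff_ (p q : fexp) : fexp := fun d e => Iff (p d e) (q d e).

Definition sentence (p : fexp) : form := p 0 0.

Declare Scope so_scope.
Delimit Scope so_scope with so.

Notation "'allN' x .. y , p" := (all_num (fun x => .. (all_num (fun y => p)) ..))
  (at level 200, x binder, y binder, right associativity) : so_scope.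
Notation "'exN' x .. y , p" := (ex_num (fun x => .. (ex_num (fun y => p)) ..))
  (at level 200, x binder, y binder, right associativity) : so_scope.
Notation "'allS' X .. Y , p" := (all_set (fun X => .. (all_set (fun Y => p)) ..))
  (at level 200, X binder, Y binder, right associativity) : so_scope.
Notation "'exS' X .. Y , p" := (ex_set (fun X => .. (ex_set (fun Y => p)) ..))
  (at level 200, X binder, Y binder, right associativity) : so_scope.
Notation "0" := zero : so_scope.
Notation "1" := one : so_scope.
Notation "x + y" := (add x y) : so_scope.
Notation "x * y" := (mul x y) : so_scope.
Notation "x ^ y" := (exp x y) : so_scope.
Notation "x = y" := (eq_num x y) : so_scope.
Notation "x < y" := (lt_num x y) : so_scope.
Notation "x <= y" := (or_ (lt_num x y) (eq_num x y)) : so_scope.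
Notation "x '\in' X" := (mem x X) (at level 70) : so_scope.
Notation "~ p" := (not_ p) : so_scope.
Notation "p /\ q" := (and_ p q) : so_scope.
Notation "p \/ q" := (or_ p q) : so_scope.
Notation "p -> q" := (imp_ p q) : so_scope.
Notation "p <-> q" := (iff_ p q) : so_scope.

(* In the bounded quantifiers the bound is shifted, so that it does not contain
   the bound variable. *)
Inductive Sigma00 : form -> Prop :=
| S00_eq t u : Sigma00 (Eq t u)
| S00_lt t u : Sigma00 (Lt t u)
| S00_mem t X : Sigma00 (Mem t X)
| S00_bot : Sigma00 Bot
| S00_imp p q : Sigma00 p -> Sigma00 q -> Sigma00 (Imp p q)
| S00_all t p : Sigma00 p -> Sigma00 (AllN (Imp (Lt (Var 0) (shift_term t)) p))
| S00_ex t p : Sigma00 p -> Sigma00 (ExN (And (Lt (Var 0) (shift_term t)) p)).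

Inductive Sigma01 : form -> Prop :=
| S01 p : Sigma00 p -> Sigma01 (ExN p).

Inductive Pi01 : form -> Prop :=
| P01 p : Sigma00 p -> Pi01 (AllN p).

Definition induction (p : form) : form :=
  let p_succ :=
    subst (fun n => match n with 0 => Add (Var 0) One | S k => Var (S k) end)
      (fun X => X) p in
  Imp (And (inst_num p Zero) (AllN (Imp p p_succ))) (AllN p).

Definition comprehension (p q : form) : form :=
  Imp (AllN (Iff p q)) (ExS (AllN (Iff (Mem (Var 0) 0) (shift_set p)))).

Inductive RCA0star : form -> Prop :=
| ax_succ_neq0 : RCA0star (sentence (allN m, ~ m + 1 = 0)%so)
| ax_succ_inj : RCA0star (sentence (allN m n, m + 1 = n + 1 -> m = n)%so)
| ax_add0 : RCA0star (sentence (allN m, m + 0 = m)%so)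
| ax_addS : RCA0star (sentence (allN m n, m + (n + 1) = (m + n) + 1)%so)
| ax_mul0 : RCA0star (sentence (allN m, m * 0 = 0)%so)
| ax_mulS : RCA0star (sentence (allN m n, m * (n + 1) = m * n + m)%so)
| ax_lt0 : RCA0star (sentence (allN m, ~ m < 0)%so)
| ax_ltS : RCA0star (sentence (allN m n, m < n + 1 <-> m < n \/ m = n)%so)
| ax_exp0 : RCA0star (sentence (allN m, m ^ 0 = 1)%so)
| ax_expS : RCA0star (sentence (allN m n, m ^ (n + 1) = m * m ^ n)%so)
| ax_induction p : Sigma00 p -> RCA0star (induction p)
| ax_comprehension p q :
    Sigma01 p -> Pi01 q -> RCA0star (comprehension p q).

Local Open Scope so_scope.

(* Injective on pairs, provably in RCA_0^*. *)
Definition pair (x y : nexp) : nexp := (x + y) * (x + y) + x.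

(* [app G x y]: G(x) = y, where functions are sets of pairs. *)
Definition app (G : sexp) (x y : nexp) : fexp := pair x y \in G.

(* [G] is the graph of a function from the class [A] to the class [B]. *)
Definition function (G : sexp) (A B : nexp -> fexp) : fexp :=
  (allN z, z \in G -> exN x y, z = pair x y /\ A x /\ B y) /\
  (allN x, A x -> exN y, app G x y /\ allN y', app G x y' -> y' = y).

Definition naturals : nexp -> fexp := fun _ => true_.
Definition below (c : nexp) : nexp -> fexp := fun x => x < c.

Definition pairs_of_interval (a R : nexp) : nexp -> fexp :=
  fun z => exN n m, z = pair n m /\ a <= n /\ n < m /\ m <= R.

(* [E] is the increasing enumeration h_0 < ... < h_(l-1) of [H]. *)
Definition enumeration (E : sexp) (l : nexp) (H : sexp) : fexp :=
  function E (below l) (fun x => x \in H) /\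
  (allN x, x \in H -> exN i, app E i x) /\
  (allN i j x y, i < j -> app E i x -> app E j y -> x < y).

Definition card (H : sexp) (l : nexp) : fexp := exS E, enumeration E l H.

Definition is_min (H : sexp) (x : nexp) : fexp :=
  x \in H /\ allN y, y \in H -> x <= y.

Definition weakly_homogeneous (C H : sexp) : fexp :=
  exS E, exN l, enumeration E l H /\
    allN i x y z, app E i x -> app E (i + 1) y -> app E (i + 1 + 1) z ->
      exN k, app C (pair x y) k /\ app C (pair y z) k.

(* The existence of a minimum makes [H] nonempty. *)
Definition WPH_at (f : sexp) (c a R : nexp) : fexp :=
  allS C, function C (pairs_of_interval a R) (below c) ->
  exS H,
    (allN x, x \in H -> a <= x /\ x <= R) /\
    weakly_homogeneous C H /\
    exN x v l, is_min H x /\ app f x v /\ card H l /\ v < l.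

Definition WPH (f : sexp) (c : nexp) : fexp :=
  allN a, exN R, WPH_at f c a R.

(* A sequence m_0, ..., m_D of elements of N^c is represented by the function
   (i, k) |-> (m_i)_k. *)
Definition sequence_indices (D c : nexp) : nexp -> fexp :=
  fun z => exN i k, z = pair i k /\ i <= D /\ k < c.

(* [v] is the maximum of the (m_i)_k for k < c. *)
Definition max_norm (M : sexp) (c i v : nexp) : fexp :=
  (c = 0 /\ v = 0) \/
  ((exN k, k < c /\ app M (pair i k) v) /\
   (allN k u, k < c -> app M (pair i k) u -> u <= v)).

Definition MDL_at (f : sexp) (c a D : nexp) : fexp :=
  allS M, function M (sequence_indices D c) naturals ->
  (allN i, i <= D -> exN v w, max_norm M c i v /\ app f (a + i) w /\ v < w) ->
  exN i j, i < j /\ j <= D /\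
    allN k, k < c -> exN u v,
      app M (pair i k) u /\ app M (pair j k) v /\ u <= v.

Definition MDL (f : sexp) (c : nexp) : fexp :=
  allN a, exN D, MDL_at f c a D.

(* Main.v *)
(* The equivalence holds pointwise: [MDL_at f c a D] if and only if
   [WPH_at f c a (a + D)].  Given a coloring, attach to [a + i] the tuple whose
   [k]-th entry is the greatest number of edges of a weakly homogeneous chain of
   color [k] starting there: if every weakly homogeneous set is small, the norms
   are small, and an edge of color [k] from [a + i] to [a + j] makes the [k]-th
   entry of the [j]-th tuple smaller than that of the [i]-th.  Given a bad
   sequence, color a pair by the least coordinate that decreases strictly.
   Derivability is obtained from the completeness theorem, so that all of this
   takes place in an arbitrary model of RCA_0^*, with [Sigma00] induction and
   [Sigma00] or [Delta01] comprehension only. *)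

From Stdlib Require Import List Arith Lia Cantor Setoid Ring.
From Stdlib Require Import Classical ClassicalEpsilon FunctionalExtensionality PropExtensionality.
Require Import Defs.
Import ListNotations.

(** Induction is available for bounded formulas only, so every inductive claim about a model carries
    explicit bounds on its witnesses. This is where exponentiation matters: a chain with [l] edges
    and vertices below [B] has a code below the term [B ^ (l + 1)], so the greatest length of a
    chain is found by a bounded search and the tuples exist by bounded comprehension. In the other
    direction no term bounds the entries of the given sequence. Comparing two entries is therefore
    first turned into a set by [Delta01] comprehension; relative to that set, the least decreasing
    coordinate is again found by a bounded search. The constants agree exactly: [l] edges span
    [l + 1] elements, so a chain from [a + i] is too small, [l + 1 <= f (a + i)], precisely when
    [l < f (a + i)], which is the strict bound on the norm. Likewise the [D + 1] tuples correspond
    to the [D + 1] points of the interval from [a] to [a + D]. *)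

Definition scons {A : Type} (a : A) (v : nat -> A) (n : nat) : A :=
  match n with 0 => a | S k => v k end.

Lemma scons_comp {A B : Type} (h : A -> B) (a : A) (v : nat -> A) :
  (fun n => h (scons a v n)) = scons (h a) (fun n => h (v n)).
Proof. apply functional_extensionality; intros [|n]; reflexivity. Qed.

(** * Substitutions *)

Lemma subst_term_comp s s' t :
  subst_term s (subst_term s' t) = subst_term (fun n => subst_term s (s' n)) t.
Proof. induction t; simpl; congruence. Qed.

Lemma subst_term_var t : subst_term Var t = t.
Proof. induction t; simpl; congruence. Qed.

Lemma up_num_shift s t :
  subst_term (up_num s) (shift_term t) = shift_term (subst_term s t).
Proof. unfold shift_term; rewrite !subst_term_comp; reflexivity. Qed.

Lemma up_num_comp s s' :
  (fun n => subst_term (up_num s) (up_num s' n)) =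
  up_num (fun n => subst_term s (s' n)).
Proof.
  apply functional_extensionality; intros [|n]; simpl; [reflexivity|].
  apply up_num_shift.
Qed.

Lemma up_num_var : up_num Var = Var.
Proof. apply functional_extensionality; intros [|n]; reflexivity. Qed.

Lemma up_set_comp r r' :
  (fun X => up_set r (up_set r' X)) = up_set (fun X => r (r' X)).
Proof. apply functional_extensionality; intros [|n]; reflexivity. Qed.

Lemma up_set_id : up_set (fun X => X) = (fun X => X).
Proof. apply functional_extensionality; intros [|n]; reflexivity. Qed.

Lemma subst_comp p : forall s r s' r',
  subst s r (subst s' r' p) =
  subst (fun n => subst_term s (s' n)) (fun X => r (r' X)) p.
Proof.
  induction p as [t u|t u|t X| |p1 IHp1 p2 IHp2|p IHp|p IHp];
    intros s r s' r'; simpl; rewrite ?subst_term_comp; try reflexivity.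
  - rewrite IHp1, IHp2; reflexivity.
  - rewrite IHp, up_num_comp; reflexivity.
  - rewrite IHp, up_set_comp; reflexivity.
Qed.

Lemma subst_id p : subst Var (fun X => X) p = p.
Proof.
  induction p as [t u|t u|t X| |p1 IHp1 p2 IHp2|p IHp|p IHp];
    simpl; rewrite ?subst_term_var, ?up_num_var, ?up_set_id; congruence.
Qed.

Lemma subst_scons_num s r p t :
  subst (scons t s) r p = inst_num (subst (up_num s) r p) t.
Proof.
  unfold inst_num; rewrite subst_comp; f_equal.
  apply functional_extensionality; intros [|n]; simpl; [reflexivity|].
  unfold shift_term; rewrite subst_term_comp; symmetry; apply subst_term_var.
Qed.

Lemma subst_scons_set s r p Y :
  subst s (scons Y r) p = inst_set (subst s (up_set r) p) Y.
Proof.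
  unfold inst_set; rewrite subst_comp; f_equal.
  - apply functional_extensionality; intro n; symmetry; apply subst_term_var.
  - apply functional_extensionality; intros [|n]; reflexivity.
Qed.

Lemma subst_inst_num s r p t :
  subst s r (inst_num p t) = inst_num (subst (up_num s) r p) (subst_term s t).
Proof.
  rewrite <- subst_scons_num; unfold inst_num; rewrite subst_comp; f_equal.
  apply functional_extensionality; intros [|n]; reflexivity.
Qed.

Lemma subst_inst_set s r p Y :
  subst s r (inst_set p Y) = inst_set (subst s (up_set r) p) (r Y).
Proof.
  rewrite <- subst_scons_set; unfold inst_set; rewrite subst_comp; f_equal.
  apply functional_extensionality; intros [|n]; reflexivity.
Qed.

Lemma subst_shift_num s r p :
  subst (up_num s) r (shift_num p) = shift_num (subst s r p).
Proof. unfold shift_num; rewrite !subst_comp; reflexivity. Qed.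

Lemma subst_shift_set s r p :
  subst s (up_set r) (shift_set p) = shift_set (subst s r p).
Proof.
  unfold shift_set; rewrite !subst_comp; f_equal.
  apply functional_extensionality; intro n; symmetry; apply subst_term_var.
Qed.

Lemma inst_shift_term t u : subst_term (scons t Var) (shift_term u) = u.
Proof. unfold shift_term; rewrite subst_term_comp; apply subst_term_var. Qed.

(** A bound on the free variables, expressed through the action of substitutions. It supplies the
    fresh variables of the Henkin construction. *)
Lemma subst_term_support t : exists n, forall s s',
  (forall i, i < n -> s i = s' i) -> subst_term s t = subst_term s' t.
Proof.
  induction t as [k| | |t [n IHn] u [m IHm]|t [n IHn] u [m IHm]|t [n IHn] u [m IHm]];
    try (exists 0; reflexivity);
    try (exists (n + m); intros s s' E; simpl; f_equal; [apply IHn|apply IHm];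
         intros; apply E; lia).
  exists (S k); intros s s' E; apply E; lia.
Qed.

Lemma subst_support p : exists n, forall s s' r r',
  (forall i, i < n -> s i = s' i) -> (forall i, i < n -> r i = r' i) ->
  subst s r p = subst s' r' p.
Proof.
  induction p as [t u|t u|t X| |p [n IHn] q [m IHm]|p [n IHn]|p [n IHn]].
  1,2: destruct (subst_term_support t) as [n Hn], (subst_term_support u) as [m Hm];
    exists (n + m); intros s s' r r' E F; simpl; f_equal; [apply Hn|apply Hm];
    intros; apply E; lia.
  - destruct (subst_term_support t) as [n Hn].
    exists (n + S X); intros s s' r r' E F; simpl; f_equal;
      [apply Hn; intros; apply E|apply F]; lia.
  - exists 0; reflexivity.
  - exists (n + m); intros s s' r r' E F; simpl; f_equal; [apply IHn|apply IHm];
    intros; (apply E || apply F); lia.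
  - exists n; intros s s' r r' E F; simpl; f_equal; apply IHn; [|exact F].
    intros [|i] H; simpl; [reflexivity|rewrite E; [reflexivity|lia]].
  - exists n; intros s s' r r' E F; simpl; f_equal; apply IHn; [exact E|].
    intros [|i] H; simpl; [reflexivity|rewrite F; [reflexivity|lia]].
Qed.

Lemma context_support G : exists n, forall p, In p G -> forall s s' r r',
  (forall i, i < n -> s i = s' i) -> (forall i, i < n -> r i = r' i) ->
  subst s r p = subst s' r' p.
Proof.
  induction G as [|p G [n IH]]; [exists 0; intros p []|].
  destruct (subst_support p) as [m Hm]; exists (n + m).
  intros q [<-|H] s s' r r' E F; [apply Hm|apply IH; [exact H| |]];
    intros; (apply E || apply F); lia.
Qed.

(** * Structures *)

Record structure : Type := Structure {
  num : Type;
  sets : Type;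
  num_zero : num;
  num_one : num;
  num_add : num -> num -> num;
  num_mul : num -> num -> num;
  num_exp : num -> num -> num;
  num_lt : num -> num -> Prop;
  num_in : num -> sets -> Prop }.

Arguments num_zero {_}.
Arguments num_one {_}.
Arguments num_add {_} _ _.
Arguments num_mul {_} _ _.
Arguments num_exp {_} _ _.
Arguments num_lt {_} _ _.
Arguments num_in {_} _ _.

Fixpoint eval {M : structure} (v : nat -> num M) (t : term) : num M :=
  match t with
  | Var n => v n
  | Zero => num_zero
  | One => num_one
  | Add t u => num_add (eval v t) (eval v u)
  | Mul t u => num_mul (eval v t) (eval v u)
  | Exp t u => num_exp (eval v t) (eval v u)
  end.

Fixpoint sat {M : structure} (v : nat -> num M) (w : nat -> sets M) (p : form) : Prop :=
  match p with
  | Eq t u => eval v t = eval v u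
  | Lt t u => num_lt (eval v t) (eval v u)
  | Mem t X => num_in (eval v t) (w X)
  | Bot => False
  | Imp p q => sat v w p -> sat v w q
  | AllN p => forall x, sat (scons x v) w p
  | AllS p => forall X, sat v (scons X w) p
  end.

Section Semantics.
Context {M : structure}.
Implicit Types (v : nat -> num M) (w : nat -> sets M).

Lemma eval_subst v s t : eval v (subst_term s t) = eval (fun n => eval v (s n)) t.
Proof. induction t; simpl; congruence. Qed.

Lemma eval_shift x v t : eval (scons x v) (shift_term t) = eval v t.
Proof. unfold shift_term; rewrite eval_subst; reflexivity. Qed.

Lemma sat_subst p : forall v w s r,
  sat v w (subst s r p) <-> sat (fun n => eval v (s n)) (fun X => w (r X)) p.
Proof.
  induction p as [t u|t u|t X| |p1 IHp1 p2 IHp2|p IHp|p IHp];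
    intros v w s r; simpl; rewrite ?eval_subst; try reflexivity.
  - rewrite IHp1, IHp2; reflexivity.
  - apply Morphisms_Prop.all_iff_morphism; intro x; rewrite IHp.
    replace (fun n => eval (scons x v) (up_num s n))
      with (scons x (fun n => eval v (s n))); [reflexivity|].
    apply functional_extensionality; intros [|n]; simpl; [|rewrite eval_shift]; reflexivity.
  - apply Morphisms_Prop.all_iff_morphism; intro X; rewrite IHp.
    replace (fun Y => scons X w (up_set r Y)) with (scons X (fun Y => w (r Y)));
      [reflexivity|].
    apply functional_extensionality; intros [|n]; reflexivity.
Qed.

Lemma sat_inst_num v w p t : sat v w (inst_num p t) <-> sat (scons (eval v t) v) w p.
Proof.
  unfold inst_num; rewrite sat_subst.
  change (fun n => eval v (match n with 0 => t | S k => Var k end))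
    with (fun n => eval v (scons t Var n)).
  rewrite scons_comp; reflexivity.
Qed.

Lemma sat_not v w p : sat v w (Not p) <-> ~ sat v w p.
Proof. reflexivity. Qed.

Lemma sat_and v w p q : sat v w (And p q) <-> sat v w p /\ sat v w q.
Proof. simpl; split; [intro H; split; apply NNPP|]; tauto. Qed.

Lemma sat_or v w p q : sat v w (Or p q) <-> sat v w p \/ sat v w q.
Proof. simpl; split; [intro H; apply NNPP|]; tauto. Qed.

Lemma sat_iff v w p q : sat v w (Iff p q) <-> (sat v w p <-> sat v w q).
Proof. unfold Iff; rewrite sat_and; reflexivity. Qed.

Lemma sat_exN v w p : sat v w (ExN p) <-> exists x, sat (scons x v) w p.
Proof.
  simpl; split; [intro H; apply NNPP; intro N; apply H; intros x Hx; eauto|].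
  intros [x Hx] H; exact (H x Hx).
Qed.

Lemma sat_exS v w p : sat v w (ExS p) <-> exists X, sat v (scons X w) p.
Proof.
  simpl; split; [intro H; apply NNPP; intro N; apply H; intros X HX; eauto|].
  intros [X HX] H; exact (H X HX).
Qed.

End Semantics.

(** * Completeness *)

(** Axioms may have free variables and are never shifted, so a derivation survives a renaming of
    variables only if the axioms do. *)
Definition subst_closed (T : form -> Prop) : Prop :=
  forall s r p, T p -> T (subst s r p).

Section Completeness.
Context (T : form -> Prop) (HT : subst_closed T).

Lemma derives_weaken G p : derives T G p -> forall G', incl G G' -> derives T G' p.
Proof.
  induction 1; intros G' I.
  - apply d_axiom; assumption.
  - apply d_hyp; auto.
  - apply d_impI, IHderives; intros r [<-|Hr]; [left|right]; auto.
  - eapply d_impE; eauto.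
  - apply d_raa, IHderives; intros r [<-|Hr]; [left|right]; auto.
  - apply d_allNI, IHderives, incl_map, I.
  - apply d_allNE; auto.
  - apply d_allSI, IHderives, incl_map, I.
  - apply d_allSE; auto.
  - apply d_refl.
  - eapply d_leibniz; eauto.
Qed.

Lemma derives_subst G p : derives T G p ->
  forall s r, derives T (map (subst s r) G) (subst s r p).
Proof.
  induction 1; intros s r.
  - apply d_axiom, HT; assumption.
  - apply d_hyp, in_map; assumption.
  - apply d_impI; apply IHderives.
  - eapply d_impE; [apply IHderives1|apply IHderives2].
  - apply d_raa; apply IHderives.
  - apply d_allNI. specialize (IHderives (up_num s) r).
    rewrite map_map in IHderives |- *.
    erewrite map_ext; [exact IHderives|]; intro q; symmetry; apply subst_shift_num.
  - rewrite subst_inst_num; apply d_allNE; apply IHderives.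
  - apply d_allSI. specialize (IHderives s (up_set r)).
    rewrite map_map in IHderives |- *.
    erewrite map_ext; [exact IHderives|]; intro q; symmetry; apply subst_shift_set.
  - rewrite subst_inst_set; apply d_allSE; apply IHderives.
  - apply d_refl.
  - rewrite subst_inst_num; apply d_leibniz with (t := subst_term s t); [apply IHderives1|].
    rewrite <- subst_inst_num; apply IHderives2.
Qed.

Definition consistent (G : list form) : Prop := ~ derives T G Bot.

(** The variable [k] is fresh for [G] and [q]: if [G] proved the instance at [Var k], generalizing
    over [k] would give [AllN q] and contradict consistency. *)
Lemma not_allN_witness G q : consistent G -> In (Not (AllN q)) G ->
  exists k, consistent (Not (inst_num q (Var k)) :: G).
Proof.
  intros C I; destruct (context_support (q :: G)) as [k Hk]; exists k; intro D.
  (* On [G] this substitution acts as the shift, and it turns the instance of [q] at [Var k] back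
     into [q], as the premise of [d_allNI] requires. *)
  set (s i := if Nat.eq_dec i k then Var 0 else Var (S i)).
  assert (E : forall i, i < k -> s i = Var (S i)).
  { intros i Hi; unfold s; destruct (Nat.eq_dec i k); [lia|reflexivity]. }
  apply C; apply d_impE with (AllN q); [apply d_hyp, I|].
  apply d_allNI; apply d_raa, derives_subst with (s := s) (r := fun X => X) in D.
  replace (subst s (fun X => X) (inst_num q (Var k))) with q in D.
  - erewrite map_ext_in; [exact D|]; intros p Hp; symmetry; apply Hk; auto; right; assumption.
  - unfold inst_num; rewrite subst_comp; rewrite <- (subst_id q) at 1.
    apply Hk; [left; reflexivity| |reflexivity].
    intros [|i] Hi; simpl; [unfold s; destruct (Nat.eq_dec k k); [reflexivity|lia]|].
    symmetry; apply E; lia.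
Qed.

Lemma not_allS_witness G q : consistent G -> In (Not (AllS q)) G ->
  exists Y, consistent (Not (inst_set q Y) :: G).
Proof.
  intros C I; destruct (context_support (q :: G)) as [k Hk]; exists k; intro D.
  set (r i := if Nat.eq_dec i k then 0 else S i).
  assert (E : forall i, i < k -> r i = S i).
  { intros i Hi; unfold r; destruct (Nat.eq_dec i k); [lia|reflexivity]. }
  apply C; apply d_impE with (AllS q); [apply d_hyp, I|].
  apply d_allSI; apply d_raa, derives_subst with (s := Var) (r := r) in D.
  replace (subst Var r (inst_set q k)) with q in D.
  - erewrite map_ext_in; [exact D|]; intros p Hp; symmetry; apply Hk; auto; right; assumption.
  - unfold inst_set; rewrite subst_comp; rewrite <- (subst_id q) at 1.
    apply Hk; [left; reflexivity|reflexivity|].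
    intros [|i] Hi; simpl; [unfold r; destruct (Nat.eq_dec k k); [reflexivity|lia]|].
    symmetry; apply E; lia.
Qed.

(** The Henkin condition is part of the negative case, so one extension step both settles a formula
    and, if it is a refuted universal one, provides a counterexample. *)
Definition decides (p : form) (G : list form) : Prop :=
  In p G \/
  In (Not p) G /\
  (forall q, p = AllN q -> exists k, In (Not (inst_num q (Var k))) G) /\
  (forall q, p = AllS q -> exists Y, In (Not (inst_set q Y)) G).

Lemma consistent_extension G p : consistent G ->
  exists G', consistent G' /\ incl G G' /\ decides p G'.
Proof.
  intro C; destruct (classic (consistent (p :: G))) as [D|D].
  - exists (p :: G); split; [exact D|split; [apply incl_tl, incl_refl|left; left; reflexivity]].
  - assert (CN : consistent (Not p :: G)).
    { intro N; apply C; apply d_impE with p; [apply d_impI, NNPP, D|apply d_raa, N]. }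
    destruct p as [t u|t u|t X| |p q|p|p].
    1-5: eexists; split; [exact CN|split; [apply incl_tl, incl_refl|]];
      right; split; [left; reflexivity|split; discriminate].
    + destruct (not_allN_witness (Not (AllN p) :: G) p CN) as [k Hk]; [left; reflexivity|].
      exists (Not (inst_num p (Var k)) :: Not (AllN p) :: G).
      split; [exact Hk|split; [apply incl_tl, incl_tl, incl_refl|]].
      right; split; [right; left; reflexivity|split; [|discriminate]].
      intros q E; injection E as <-; exists k; left; reflexivity.
    + destruct (not_allS_witness (Not (AllS p) :: G) p CN) as [k Hk]; [left; reflexivity|].
      exists (Not (inst_set p k) :: Not (AllS p) :: G).
      split; [exact Hk|split; [apply incl_tl, incl_tl, incl_refl|]].
      right; split; [right; left; reflexivity|split; [discriminate|]].
      intros q E; injection E as <-; exists k; left; reflexivity.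
Qed.

End Completeness.

(** * Injective codes for formulas *)

Lemma cantor_inj a b c d : to_nat (a, b) = to_nat (c, d) -> a = c /\ b = d.
Proof.
  intro E; apply (f_equal of_nat) in E; rewrite !cancel_of_to in E.
  injection E; auto.
Qed.

Fixpoint term_code (t : term) : nat :=
  match t with
  | Var n => to_nat (0, n)
  | Zero => to_nat (1, 0)
  | One => to_nat (2, 0)
  | Add t u => to_nat (3, to_nat (term_code t, term_code u))
  | Mul t u => to_nat (4, to_nat (term_code t, term_code u))
  | Exp t u => to_nat (5, to_nat (term_code t, term_code u))
  end.

Fixpoint form_code (p : form) : nat :=
  match p with
  | Eq t u => to_nat (0, to_nat (term_code t, term_code u))
  | Lt t u => to_nat (1, to_nat (term_code t, term_code u))
  | Mem t X => to_nat (2, to_nat (term_code t, X))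
  | Bot => to_nat (3, 0)
  | Imp p q => to_nat (4, to_nat (form_code p, form_code q))
  | AllN p => to_nat (5, form_code p)
  | AllS p => to_nat (6, form_code p)
  end.

Ltac split_codes :=
  repeat match goal with
  | H : to_nat (_, _) = to_nat (_, _) |- _ =>
      apply cantor_inj in H; destruct H; try discriminate
  end.

Lemma term_code_inj t : forall u, term_code t = term_code u -> t = u.
Proof.
  induction t; intros [] E; cbn [term_code] in E; split_codes; f_equal; auto.
Qed.

Lemma form_code_inj p : forall q, form_code p = form_code q -> p = q.
Proof.
  induction p as [t u|t u|t X| |p1 IHp1 p2 IHp2|p IHp|p IHp];
    intros [] E; cbn [form_code] in E; split_codes; f_equal; auto using term_code_inj.
Qed.

(** A number that codes no formula yields an arbitrary one; this is harmless, since a stage may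
    decide any formula. *)
Definition nth_form (n : nat) : form :=
  epsilon (inhabits Bot) (fun p => form_code p = n).

Lemma nth_form_code p : nth_form (form_code p) = p.
Proof.
  apply form_code_inj; unfold nth_form; apply epsilon_spec; exists p; reflexivity.
Qed.

(** * The complete Henkin theory and its term model *)

Section Henkin.
Context (T : form -> Prop) (HT : subst_closed T).

Definition context : Type := { G : list form | consistent T G }.

Definition extend (G : context) (p : form) : context :=
  let E := constructive_indefinite_description _
    (consistent_extension T HT (proj1_sig G) p (proj2_sig G)) in
  exist _ (proj1_sig E) (proj1 (proj2_sig E)).

Lemma extend_incl G p : incl (proj1_sig G) (proj1_sig (extend G p)).
Proof. unfold extend; destruct constructive_indefinite_description as [G' H]; apply H. Qed.

Lemma extend_decides G p : decides p (proj1_sig (extend G p)).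
Proof. unfold extend; destruct constructive_indefinite_description as [G' H]; apply H. Qed.

Context (G0 : context).

Fixpoint stage (n : nat) : context :=
  match n with 0 => G0 | S k => extend (stage k) (nth_form k) end.

Lemma stage_incl n m : n <= m -> incl (proj1_sig (stage n)) (proj1_sig (stage m)).
Proof.
  induction 1; [apply incl_refl|].
  eapply incl_tran; [exact IHle|apply extend_incl].
Qed.

Definition true_form (p : form) : Prop := exists n, In p (proj1_sig (stage n)).

Lemma true_form_decides p : exists n, decides p (proj1_sig (stage n)).
Proof.
  exists (S (form_code p)); simpl; rewrite nth_form_code; apply extend_decides.
Qed.

(** Compactness: the stages increase, so finitely many true formulas share a stage. *)
Lemma true_form_stage G : (forall p, In p G -> true_form p) ->
  exists n, incl G (proj1_sig (stage n)).
Proof.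
  induction G as [|p G IH]; intro H; [exists 0; intros q []|].
  destruct IH as [n Hn]; [intros; apply H; right; assumption|].
  destruct (H p) as [m Hm]; [left; reflexivity|].
  exists (n + m); intros q [<-|Hq].
  - apply (stage_incl m); [lia|exact Hm].
  - apply (stage_incl n); [lia|apply Hn, Hq].
Qed.

(** If [p] failed, its negation would occur at some stage, and a later stage containing [G] as well
    would be inconsistent. *)
Lemma true_form_derives G p :
  derives T G p -> (forall q, In q G -> true_form q) -> true_form p.
Proof.
  intros D H; destruct (true_form_decides p) as [m [Hm|[Hm _]]]; [exists m; exact Hm|].
  destruct (true_form_stage G H) as [n Hn].
  exfalso; apply (proj2_sig (stage (n + m))).
  apply d_impE with p.
  - apply d_hyp, (stage_incl m); [lia|exact Hm].
  - apply derives_weaken with G; [exact D|].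
    eapply incl_tran; [exact Hn|apply stage_incl; lia].
Qed.

Lemma true_form_bot : ~ true_form Bot.
Proof. intros [n Hn]; apply (proj2_sig (stage n)), d_hyp, Hn. Qed.

Lemma true_form_not p : true_form (Not p) -> ~ true_form p.
Proof.
  intros H K; apply true_form_bot, (true_form_derives [Not p; p]).
  - apply d_impE with p; apply d_hyp; simpl; auto.
  - intros q [<-|[<-|[]]]; assumption.
Qed.

Lemma true_form_or_not p : true_form p \/ true_form (Not p).
Proof.
  destruct (true_form_decides p) as [n [H|[H _]]]; [left|right]; exists n; exact H.
Qed.

Lemma true_form_imp p q : true_form (Imp p q) <-> (true_form p -> true_form q).
Proof.
  split; intro H.
  - intro K; apply (true_form_derives [Imp p q; p]).
    + apply d_impE with p; apply d_hyp; simpl; auto.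
    + intros r [<-|[<-|[]]]; assumption.
  - destruct (true_form_or_not p) as [K|K].
    + apply (true_form_derives [q]); [apply d_impI, d_hyp; simpl; auto|].
      intros r [<-|[]]; auto.
    + apply (true_form_derives [Not p]); [|intros r [<-|[]]; auto].
      apply d_impI, d_raa, d_impE with p; apply d_hyp; simpl; auto.
Qed.

Lemma true_form_allN p : true_form (AllN p) <-> forall t, true_form (inst_num p t).
Proof.
  split; intro H.
  - intro t; apply (true_form_derives [AllN p]); [|intros r [<-|[]]; auto].
    apply d_allNE, d_hyp; left; reflexivity.
  - destruct (true_form_decides (AllN p)) as [n [K|[_ [K _]]]]; [exists n; exact K|].
    destruct (K p eq_refl) as [k Hk]; exfalso.
    apply (true_form_not (inst_num p (Var k))); [exists n; exact Hk|apply H].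
Qed.

Lemma true_form_allS p : true_form (AllS p) <-> forall Y, true_form (inst_set p Y).
Proof.
  split; intro H.
  - intro Y; apply (true_form_derives [AllS p]); [|intros r [<-|[]]; auto].
    apply d_allSE, d_hyp; left; reflexivity.
  - destruct (true_form_decides (AllS p)) as [n [K|[_ [_ K]]]]; [exists n; exact K|].
    destruct (K p eq_refl) as [k Hk]; exfalso.
    apply (true_form_not (inst_set p k)); [exists n; exact Hk|apply H].
Qed.

Lemma true_form_axiom p : T p -> true_form p.
Proof. intro H; apply (true_form_derives []); [apply d_axiom, H|intros q []]. Qed.

Lemma true_eq_refl t : true_form (Eq t t).
Proof. apply (true_form_derives []); [apply d_refl|intros q []]. Qed.

Lemma true_eq_leibniz p t u :
  true_form (Eq t u) -> true_form (inst_num p t) -> true_form (inst_num p u).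
Proof.
  intros H K; apply (true_form_derives [Eq t u; inst_num p t]).
  - apply d_leibniz with t; apply d_hyp; simpl; auto.
  - intros q [<-|[<-|[]]]; assumption.
Qed.

Lemma inst_num_eq t u u' :
  inst_num (Eq u (shift_term u')) t = Eq (subst_term (scons t Var) u) u'.
Proof. change (Eq (subst_term (scons t Var) u) (subst_term (scons t Var) (shift_term u')) =
  Eq (subst_term (scons t Var) u) u'); rewrite inst_shift_term; reflexivity. Qed.

Lemma true_eq_sym t u : true_form (Eq t u) -> true_form (Eq u t).
Proof.
  intro H; pose proof (true_eq_leibniz (Eq (Var 0) (shift_term t)) t u H) as L.
  rewrite !inst_num_eq in L; exact (L (true_eq_refl t)).
Qed.

Lemma true_eq_trans t u u' :
  true_form (Eq t u) -> true_form (Eq u u') -> true_form (Eq t u').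
Proof.
  intros H K; apply true_eq_sym in H.
  pose proof (true_eq_leibniz (Eq (Var 0) (shift_term u')) u t H) as L.
  rewrite !inst_num_eq in L; exact (L K).
Qed.

(** One argument is replaced at a time, by Leibniz with the hole [Var 0] in that argument;
    everything else is shifted and so left alone by the instantiation. *)
Lemma true_eq_cong (op : term -> term -> term)
  (Hop : forall s t u, subst_term s (op t u) = op (subst_term s t) (subst_term s u))
  t t' u u' :
  true_form (Eq t t') -> true_form (Eq u u') -> true_form (Eq (op t u) (op t' u')).
Proof.
  intros H K; apply true_eq_trans with (op t u').
  - pose proof (true_eq_leibniz (Eq (op (shift_term t) (Var 0)) (shift_term (op t u)))
      u u' K) as L.
    rewrite !inst_num_eq, !Hop, !inst_shift_term in L; apply true_eq_sym, L, true_eq_refl.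
  - pose proof (true_eq_leibniz (Eq (op (Var 0) (shift_term u')) (shift_term (op t u')))
      t t' H) as L.
    rewrite !inst_num_eq, !Hop, !inst_shift_term in L; apply true_eq_sym, L, true_eq_refl.
Qed.

Lemma true_lt_cong t t' u u' :
  true_form (Eq t t') -> true_form (Eq u u') -> true_form (Lt t u) -> true_form (Lt t' u').
Proof.
  intros H K L.
  pose proof (true_eq_leibniz (Lt (Var 0) (shift_term u)) t t' H) as L1.
  pose proof (true_eq_leibniz (Lt (shift_term t') (Var 0)) u u' K) as L2.
  change (true_form (Lt t (subst_term (scons t Var) (shift_term u))) ->
    true_form (Lt t' (subst_term (scons t' Var) (shift_term u)))) in L1.
  change (true_form (Lt (subst_term (scons u Var) (shift_term t')) u) ->
    true_form (Lt (subst_term (scons u' Var) (shift_term t')) u')) in L2.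
  rewrite !inst_shift_term in L1, L2; auto.
Qed.

Lemma true_mem_cong t t' X :
  true_form (Eq t t') -> true_form (Mem t X) -> true_form (Mem t' X).
Proof. exact (true_eq_leibniz (Mem (Var 0) X) t t'). Qed.

(* The numbers of the term model are the terms that their class chooses as
   representatives. *)
Definition repr (t : term) : term := epsilon (inhabits Zero) (fun u => true_form (Eq t u)).

Lemma repr_eq t : true_form (Eq t (repr t)).
Proof. unfold repr; apply epsilon_spec; exists t; apply true_eq_refl. Qed.

(** Provably equal terms have the same candidates, so by extensionality [epsilon] makes the same
    choice. Equality in the model thus becomes genuine equality, which is how [sat] reads [Eq]. *)
Lemma repr_cong t u : true_form (Eq t u) -> repr t = repr u.
Proof.
  intro H; unfold repr; f_equal; apply functional_extensionality; intro u'.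
  apply propositional_extensionality; split; apply true_eq_trans; auto using true_eq_sym.
Qed.

Definition term_num : Type := { t : term | repr t = t }.

Definition cls (t : term) : term_num :=
  exist _ (repr t) (eq_sym (repr_cong _ _ (repr_eq t))).

Lemma cls_eq t u : cls t = cls u <-> true_form (Eq t u).
Proof.
  split; intro H.
  - apply (f_equal (@proj1_sig _ _)) in H; simpl in H.
    apply true_eq_trans with (repr t); [apply repr_eq|].
    rewrite H; apply true_eq_sym, repr_eq.
  - apply eq_sig_hprop; [intros; apply proof_irrelevance|apply repr_cong, H].
Qed.

Lemma cls_proj (x : term_num) : cls (proj1_sig x) = x.
Proof. apply eq_sig_hprop; [intros; apply proof_irrelevance|apply (proj2_sig x)]. Qed.

Definition term_model : structure :=
  let op (f : term -> term -> term) (x y : term_num) := cls (f (proj1_sig x) (proj1_sig y)) in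
  Structure term_num nat (cls Zero) (cls One) (op Add) (op Mul) (op Exp)
    (fun x y => true_form (Lt (proj1_sig x) (proj1_sig y)))
    (fun x X => true_form (Mem (proj1_sig x) X)).

Lemma eval_term_model (s : nat -> term) t :
  @eval term_model (fun n => cls (s n)) t = cls (subst_term s t).
Proof.
  induction t as [k| | |t IHt u IHu|t IHt u IHu|t IHt u IHu]; try reflexivity.
  all: simpl in *; rewrite IHt, IHu; apply cls_eq, true_eq_cong; [reflexivity| |];
    apply true_eq_sym, repr_eq.
Qed.

(** The truth lemma. It is stated for arbitrary [s] and [r] because passing under a quantifier
    changes the assignment. *)
Lemma sat_term_model p : forall s r,
  @sat term_model (fun n => cls (s n)) r p <-> true_form (subst s r p).
Proof.
  induction p as [t u|t u|t X| |p1 IHp1 p2 IHp2|p IHp|p IHp];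
    intros s r; cbn [sat subst]; rewrite ?eval_term_model.
  - apply cls_eq.
  - split; apply true_lt_cong; auto using true_eq_sym, repr_eq.
  - split; apply true_mem_cong; auto using true_eq_sym, repr_eq.
  - split; [tauto|apply true_form_bot].
  - rewrite IHp1, IHp2, true_form_imp; reflexivity.
  - rewrite true_form_allN; split.
    + intros H t; rewrite <- subst_scons_num; apply IHp.
      rewrite scons_comp; apply (H (cls t)).
    (* Every element is the class of its own representative, so instances at terms reach all
       elements. *)
    + intros H x; specialize (H (proj1_sig x)).
      rewrite <- subst_scons_num in H; apply IHp in H.
      rewrite scons_comp, cls_proj in H; exact H.
  - rewrite true_form_allS; split.
    + intros H Y; rewrite <- subst_scons_set; apply IHp, H.
    + intros H Y; apply IHp; rewrite subst_scons_set; apply H.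
Qed.

Lemma term_model_axiom p v w : T p -> @sat term_model v w p.
Proof.
  intro H; replace v with (fun n => cls (proj1_sig (v n))).
  - apply sat_term_model, true_form_axiom, HT, H.
  - apply functional_extensionality; intro n; apply cls_proj.
Qed.

End Henkin.

(* In the term model every element is named by the canonical assignment, so
   definability there needs no parameters. *)
Theorem completeness (T : form -> Prop) (p : form) :
  subst_closed T ->
  (forall (M : structure) (v : nat -> num M) (w : nat -> sets M),
     (forall q (v' : nat -> num M) (w' : nat -> sets M), T q -> sat v' w' q) ->
     (forall x, exists t, eval v t = x) -> (forall X, exists Y, w Y = X) ->
     sat v w p) ->
  proves T p.
Proof.
  intros HT H; apply NNPP; intro N.
  assert (C : consistent T [Not p]) by (intro D; apply N, d_raa, D).
  set (G0 := exist _ [Not p] C : context T).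
  assert (K : true_form T HT G0 (Not p)) by (exists 0; left; reflexivity).
  apply true_form_not in K; apply K.
  rewrite <- (subst_id p); apply sat_term_model, H.
  - apply term_model_axiom.
  - intro x; exists (proj1_sig x).
    rewrite eval_term_model, subst_term_var; apply cls_proj.
  - intro X; exists X; reflexivity.
Qed.

(** * Closure of the axioms under substitution *)

Lemma Sigma00_subst p : Sigma00 p -> forall s r, Sigma00 (subst s r p).
Proof.
  induction 1; intros s r; cbn; try (constructor; auto; fail).
  - rewrite up_num_shift; apply (S00_all (subst_term s t)); apply IHSigma00.
  - rewrite up_num_shift; apply (S00_ex (subst_term s t)); apply IHSigma00.
Qed.

(** The basic axioms are closed, and the two schemes admit arbitrary parameters, so a substituted
    instance is an instance for the substituted formulas. *)
Lemma RCA0star_subst : subst_closed RCA0star.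
Proof.
  intros s r p H.
  set (succ := fun n => match n with 0 => Add (Var 0) One | S k => Var (S k) end).
  destruct H; try (constructor; fail).
  - replace (subst s r (induction p)) with (induction (subst (up_num s) r p));
      [apply ax_induction, Sigma00_subst; assumption|].
    assert (E : subst (up_num s) r (subst succ (fun X => X) p) =
                subst succ (fun X => X) (subst (up_num s) r p)).
    { rewrite !subst_comp; f_equal.
      apply functional_extensionality; intros [|n]; cbn; [reflexivity|].
      unfold shift_term; rewrite subst_term_comp; reflexivity. }
    unfold induction, And, Not; cbn [subst]; rewrite subst_inst_num; fold succ.
    rewrite E; reflexivity.
  - replace (subst s r (comprehension p q))
      with (comprehension (subst (up_num s) r p) (subst (up_num s) r q)).
    + destruct H as [p H], H0 as [q H0]; apply ax_comprehension; cbn; constructor;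
        apply Sigma00_subst; assumption.
    + unfold comprehension; cbn; rewrite subst_shift_set; reflexivity.
Qed.

(** * Definability in a model *)

Declare Scope num_scope.
Delimit Scope num_scope with num.
Notation "0" := num_zero : num_scope.
Notation "1" := num_one : num_scope.
Notation "x + y" := (num_add x y) : num_scope.
Notation "x * y" := (num_mul x y) : num_scope.
Notation "x ^ y" := (num_exp x y) : num_scope.
Notation "x < y" := (num_lt x y) : num_scope.
Notation "x '\in' X" := (num_in x X) (at level 70) : num_scope.
Notation "x <= y" := (x < y \/ x = y)%num : num_scope.

Record named_model (M : structure) (v : nat -> num M) (w : nat -> sets M) : Prop := {
  model_axiom : forall p v' w', RCA0star p -> @sat M v' w' p;
  name_num : forall x, exists t, eval v t = x;
  name_set : forall X, exists Y, w Y = X }.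

(** The values of the [k] innermost number variables, the most recent in [snd]. Definability under
    [k] bounded quantifiers then concerns an ordinary predicate on this type, while all parameters
    are named by the underlying assignment. *)
Fixpoint ctx (M : structure) (k : nat) : Type :=
  match k with 0 => unit | S k => (ctx M k * num M)%type end.

Section Definability.
Context {M : structure} {v : nat -> num M} {w : nat -> sets M}.
Local Open Scope num_scope.

Fixpoint env (v : nat -> num M) (k : nat) : ctx M k -> nat -> num M :=
  match k with 0 => fun _ => v | S k => fun e => scons (snd e) (env v k (fst e)) end.

Definition tm (k : nat) (f : ctx M k -> num M) : Prop :=
  exists t, forall e, eval (env v k e) t = f e.

Definition delta0 (k : nat) (P : ctx M k -> Prop) : Prop :=
  exists p, Sigma00 p /\ forall e, sat (env v k e) w p <-> P e.

Lemma tm_weaken k f : tm k f -> tm (S k) (fun e => f (fst e)).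
Proof. intros [t Ht]; exists (shift_term t); intro e; simpl; rewrite eval_shift; apply Ht. Qed.

Lemma delta0_weaken k P : delta0 k P -> delta0 (S k) (fun e => P (fst e)).
Proof.
  intros [p [Hp E]]; exists (shift_num p); split; [apply Sigma00_subst, Hp|].
  intro e; unfold shift_num; rewrite sat_subst; apply E.
Qed.

Lemma tm_add k f g : tm k f -> tm k g -> tm k (fun e => f e + g e).
Proof. intros [t Ht] [u Hu]; exists (Add t u); intro e; simpl; congruence. Qed.

Lemma tm_mul k f g : tm k f -> tm k g -> tm k (fun e => f e * g e).
Proof. intros [t Ht] [u Hu]; exists (Mul t u); intro e; simpl; congruence. Qed.

Lemma tm_exp k f g : tm k f -> tm k g -> tm k (fun e => f e ^ g e).
Proof. intros [t Ht] [u Hu]; exists (Exp t u); intro e; simpl; congruence. Qed.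

Lemma delta0_eq k f g : tm k f -> tm k g -> delta0 k (fun e => f e = g e).
Proof.
  intros [t Ht] [u Hu]; exists (Eq t u); split; [constructor|].
  intro e; simpl; rewrite Ht, Hu; reflexivity.
Qed.

Lemma delta0_lt k f g : tm k f -> tm k g -> delta0 k (fun e => f e < g e).
Proof.
  intros [t Ht] [u Hu]; exists (Lt t u); split; [constructor|].
  intro e; simpl; rewrite Ht, Hu; reflexivity.
Qed.

Lemma delta0_imp k P Q : delta0 k P -> delta0 k Q -> delta0 k (fun e => P e -> Q e).
Proof.
  intros [p [Hp Ep]] [q [Hq Eq]]; exists (Imp p q); split; [constructor; assumption|].
  intro e; simpl; rewrite Ep, Eq; reflexivity.
Qed.

Lemma delta0_not k P : delta0 k P -> delta0 k (fun e => ~ P e).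
Proof.
  intros [p [Hp Ep]]; exists (Not p); split; [repeat constructor; assumption|].
  intro e; rewrite sat_not, Ep; reflexivity.
Qed.

Lemma delta0_and k P Q : delta0 k P -> delta0 k Q -> delta0 k (fun e => P e /\ Q e).
Proof.
  intros [p [Hp Ep]] [q [Hq Eq]]; exists (And p q); split; [repeat constructor; assumption|].
  intro e; rewrite sat_and, Ep, Eq; reflexivity.
Qed.

Lemma delta0_or k P Q : delta0 k P -> delta0 k Q -> delta0 k (fun e => P e \/ Q e).
Proof.
  intros [p [Hp Ep]] [q [Hq Eq]]; exists (Or p q); split; [repeat constructor; assumption|].
  intro e; rewrite sat_or, Ep, Eq; reflexivity.
Qed.

Lemma delta0_all k f (P : ctx M k -> num M -> Prop) :
  tm k f -> delta0 (S k) (fun e => P (fst e) (snd e)) ->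
  delta0 k (fun e => forall x, x < f e -> P e x).
Proof.
  intros [t Ht] [p [Hp Ep]]; exists (AllN (Imp (Lt (Var 0) (shift_term t)) p)).
  split; [constructor; assumption|].
  intro e; cbn [sat]; apply Morphisms_Prop.all_iff_morphism; intro x.
  specialize (Ep (e, x)); simpl in Ep |- *; rewrite eval_shift, Ht, Ep; reflexivity.
Qed.

Lemma delta0_ex k f (P : ctx M k -> num M -> Prop) :
  tm k f -> delta0 (S k) (fun e => P (fst e) (snd e)) ->
  delta0 k (fun e => exists x, x < f e /\ P e x).
Proof.
  intros [t Ht] [p [Hp Ep]]; exists (ExN (And (Lt (Var 0) (shift_term t)) p)).
  split; [constructor; assumption|].
  intro e; rewrite sat_exN; apply Morphisms_Prop.ex_iff_morphism; intro x.
  rewrite sat_and; specialize (Ep (e, x)); simpl in Ep |- *.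
  rewrite eval_shift, Ht, Ep; reflexivity.
Qed.

Context (HM : named_model M v w).

Lemma tm_const k (x : num M) : tm k (fun _ => x).
Proof.
  induction k as [|k IH]; [destruct (name_num _ _ _ HM x) as [t Ht]; exists t; intro; exact Ht|].
  exact (tm_weaken k _ IH).
Qed.

Lemma delta0_in k f X : tm k f -> delta0 k (fun e => f e \in X).
Proof.
  intros [t Ht]; destruct (name_set _ _ _ HM X) as [Y <-].
  exists (Mem t Y); split; [constructor|].
  intro e; simpl; rewrite Ht; reflexivity.
Qed.

Lemma env_add k e n : env v k e (k + n) = v n.
Proof. induction k as [|k IH]; [reflexivity|apply IH]. Qed.

(** Lets a predicate already known to be bounded occur inside a larger formula. Its parameters are
    re-addressed as [Var (k + n)], past the [k] variables of the context. *)
Lemma delta0_pred k (P : num M -> Prop) f :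
  delta0 1 (fun e => P (snd e)) -> tm k f -> delta0 k (fun e => P (f e)).
Proof.
  intros [p [Hp E]] [t Ht].
  exists (subst (scons t (fun n => Var (k + n))) (fun X => X) p).
  split; [apply Sigma00_subst, Hp|]; intro e.
  rewrite sat_subst, scons_comp, Ht; simpl.
  replace (fun n => env v k e (k + n)) with v; [apply (E (tt, f e))|].
  apply functional_extensionality; intro n; symmetry; apply env_add.
Qed.

Lemma delta0_induction (P : num M -> Prop) :
  delta0 1 (fun e => P (snd e)) ->
  P 0 -> (forall x, P x -> P (x + 1)) -> forall x, P x.
Proof.
  intros [p [Hp E]] P0 PS.
  assert (E' : forall x, sat (scons x v) w p <-> P x) by (intro x; apply (E (tt, x))).
  pose proof (model_axiom _ _ _ HM _ v w (ax_induction p Hp)) as A.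
  unfold induction in A; cbn [sat] in A; rewrite sat_and in A; cbn [sat] in A.
  intro x; apply E', A; split.
  - rewrite sat_inst_num; apply E', P0.
  - intros y Hy; rewrite sat_subst.
    replace (fun n => _) with (scons (y + 1) v); [apply E', PS, E', Hy|].
    apply functional_extensionality; intros [|n]; reflexivity.
Qed.

Lemma delta1_comprehension (P Q : num M -> num M -> Prop) :
  delta0 2 (fun e => P (snd (fst e)) (snd e)) ->
  delta0 2 (fun e => Q (snd (fst e)) (snd e)) ->
  (forall x, (exists y, P x y) <-> (forall y, Q x y)) ->
  exists X, forall x, x \in X <-> exists y, P x y.
Proof.
  intros [p [Hp Ep]] [q [Hq Eq]] H.
  pose proof (model_axiom _ _ _ HM _ v w
    (ax_comprehension (ExN p) (AllN q) (S01 p Hp) (P01 q Hq))) as A.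
  assert (Ep' : forall x, sat (scons x v) w (ExN p) <-> exists y, P x y).
  { intro x; rewrite sat_exN; apply Morphisms_Prop.ex_iff_morphism; intro y.
    apply (Ep (tt, x, y)). }
  unfold comprehension in A.
  assert (A' : sat v w (ExS (AllN (Iff (Mem (Var 0) 0) (shift_set (ExN p)))))).
  { apply A; intro x; rewrite sat_iff, Ep', H; cbn [sat].
    apply Morphisms_Prop.all_iff_morphism; intro y; symmetry; apply (Eq (tt, x, y)). }
  rewrite sat_exS in A'; destruct A' as [X HX]; exists X; intro x.
  specialize (HX x); rewrite sat_iff in HX; unfold shift_set in HX.
  rewrite sat_subst in HX; etransitivity; [exact HX|exact (Ep' x)].
Qed.

(** A vacuous quantifier makes a bounded predicate both [Sigma01] and [Pi01]. *)
Lemma delta0_comprehension (P : num M -> Prop) :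
  delta0 1 (fun e => P (snd e)) -> exists X, forall x, x \in X <-> P x.
Proof.
  intro D; pose proof (delta0_weaken 1 _ D) as D'.
  destruct (delta1_comprehension (fun x _ => P x) (fun x _ => P x) D' D') as [X HX].
  - intro x; split; [intros [_ H] _; exact H|intro H; exists 0; exact (H 0)].
  - exists X; intro x; rewrite HX; split; [intros [_ H]; exact H|intro H; exists 0; exact H].
Qed.

End Definability.

Ltac tm_var i :=
  first [exists (Var i); intro; reflexivity | tm_var (S i)].

Ltac tm :=
  cbv beta;
  lazymatch goal with
  | |- tm _ (fun _ => ?c) => eapply tm_const; eassumption
  | |- tm _ (fun e => (@?f e + @?g e)%num) => apply tm_add; tm
  | |- tm _ (fun e => (@?f e * @?g e)%num) => apply tm_mul; tm
  | |- tm _ (fun e => (@?f e ^ @?g e)%num) => apply tm_exp; tm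
  | |- _ => tm_var 0
  end.

(** The clauses follow the shape of the predicate. Quantifiers are recognized only when followed at
    once by a strict bound, which is why later formulas say [i < D + 1] and list each bound next to
    its variable. *)
Ltac delta0 :=
  cbv beta;
  lazymatch goal with
  | |- delta0 _ (fun e => @?P e /\ @?Q e) => apply delta0_and; delta0
  | |- delta0 _ (fun e => @?P e \/ @?Q e) => apply delta0_or; delta0
  | |- delta0 _ (fun e => ~ @?P e) => apply delta0_not; delta0
  | |- delta0 _ (fun e => @?f e = @?g e) => apply delta0_eq; tm
  | |- delta0 _ (fun e => num_lt (@?f e) (@?g e)) => apply delta0_lt; tm
  | |- delta0 _ (fun e => num_in (@?f e) ?X) => apply delta0_in; [assumption|tm]
  | |- delta0 _ (fun e => exists x, num_lt x (@?f e) /\ @?P e x) =>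
      apply (delta0_ex _ f P); [tm|delta0]
  | |- delta0 _ (fun e => forall x, num_lt x (@?f e) -> @?P e x) =>
      apply (delta0_all _ f P); [tm|delta0]
  | |- delta0 _ (fun e => @?P e -> @?Q e) => apply delta0_imp; delta0
  | |- delta0 _ (fun e => ?P (@?f e)) => apply (delta0_pred _ P f); [assumption|tm]
  end.

(** * Arithmetic in a model *)

Section Arithmetic.
Context {M : structure} {v : nat -> num M} {w : nat -> sets M} (HM : named_model M v w).
Local Open Scope num_scope.
Implicit Types x y z d b q r : num M.

Ltac of_axiom a :=
  let H := fresh in
  pose proof (model_axiom _ _ _ HM _ v w a) as H; cbn in H.

Lemma succ_inj x y : x + 1 = y + 1 -> x = y.
Proof. of_axiom ax_succ_inj; auto. Qed.

Lemma add0r x : x + 0 = x.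
Proof. of_axiom ax_add0; auto. Qed.

Lemma addrS x y : x + (y + 1) = (x + y) + 1.
Proof. of_axiom ax_addS; auto. Qed.

Lemma mulr0 x : x * 0 = 0.
Proof. of_axiom ax_mul0; auto. Qed.

Lemma mulrS x y : x * (y + 1) = x * y + x.
Proof. of_axiom ax_mulS; auto. Qed.

Lemma nlt0 x : ~ x < 0.
Proof. of_axiom ax_lt0; exact (H x). Qed.

Lemma ltS x y : x < y + 1 <-> x <= y.
Proof. of_axiom ax_ltS; specialize (H x y); tauto. Qed.

Lemma exp0 x : x ^ 0 = 1.
Proof. of_axiom ax_exp0; auto. Qed.

Lemma expS x y : x ^ (y + 1) = x * x ^ y.
Proof. of_axiom ax_expS; auto. Qed.

Ltac ind z := pattern z; revert z; apply (delta0_induction HM); [delta0| |].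

Lemma add0l x : 0 + x = x.
Proof. ind x; [apply add0r|]; intros x IH; rewrite addrS, IH; reflexivity. Qed.

Lemma addlS x y : (x + 1) + y = (x + y) + 1.
Proof.
  ind y; [rewrite !add0r; reflexivity|].
  intros y IH; rewrite !addrS, IH; reflexivity.
Qed.

Lemma addC x y : x + y = y + x.
Proof.
  ind y; [rewrite add0r, add0l; reflexivity|].
  intros y IH; rewrite addrS, addlS, IH; reflexivity.
Qed.

Lemma addA x y z : x + (y + z) = (x + y) + z.
Proof.
  ind z; [rewrite !add0r; reflexivity|].
  intros z IH; rewrite !addrS, IH; reflexivity.
Qed.

Lemma mul0l x : 0 * x = 0.
Proof. ind x; [apply mulr0|]; intros x IH; rewrite mulrS, IH; apply add0r. Qed.

Lemma mullS x y : (x + 1) * y = x * y + y.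
Proof.
  ind y; [rewrite !mulr0, add0r; reflexivity|].
  intros y IH; rewrite !mulrS, IH, <- !addA; f_equal.
  rewrite !addA, (addC y x); reflexivity.
Qed.

Lemma mulC x y : x * y = y * x.
Proof.
  ind y; [rewrite mulr0, mul0l; reflexivity|].
  intros y IH; rewrite mulrS, mullS, IH; reflexivity.
Qed.

Lemma mulDl x y z : (x + y) * z = x * z + y * z.
Proof.
  ind z; [rewrite !mulr0, add0r; reflexivity|].
  intros z IH; rewrite !mulrS, IH, <- !addA; f_equal.
  rewrite !addA; f_equal; apply addC.
Qed.

Lemma mulA x y z : x * (y * z) = (x * y) * z.
Proof.
  ind z; [rewrite !mulr0; reflexivity|].
  intros z IH; rewrite !mulrS, <- IH, (mulC x), mulDl, (mulC (y * z) x), (mulC y x); reflexivity.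
Qed.

Lemma mul1l x : 1 * x = x.
Proof. rewrite mulC, <- (add0l 1), mulrS, mulr0, add0l; reflexivity. Qed.

Lemma num_semi_ring : semi_ring_theory (@num_zero M) num_one num_add num_mul (@eq (num M)).
Proof.
  constructor; auto using add0l, addC, addA, mul1l, mul0l, mulC, mulA, mulDl.
Qed.

Add Ring num_ring : num_semi_ring.

Lemma zero_or_succ x : x = 0 \/ exists y, x = y + 1.
Proof.
  (* The predecessor is bounded by [x] itself, which makes the induction formula bounded. The same
     device recurs below. *)
  cut (x = 0 \/ exists y, y < x /\ x = y + 1); [intros [H|[y [_ H]]]; eauto|].
  ind x; [left; reflexivity|].
  intros x _; right; exists x; split; [apply ltS; right|]; reflexivity.
Qed.

Lemma lt_trans x y z : x < y -> y < z -> x < z.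
Proof.
  intro H; ind z; [intro K; destruct (nlt0 _ K)|].
  intros z IH K; apply ltS; left; apply ltS in K; destruct K as [K| <-]; auto.
Qed.

Lemma lt_irrefl x : ~ x < x.
Proof.
  ind x; [apply nlt0|].
  intros x IH K; apply ltS in K; apply IH.
  assert (L : x < x + 1) by (apply ltS; right; reflexivity).
  destruct K as [K|K]; [exact (lt_trans _ _ _ L K)|rewrite K in L; exact L].
Qed.

Lemma lt_succ_succ x y : x < y -> x + 1 < y + 1.
Proof.
  ind y; [intro K; destruct (nlt0 _ K)|].
  intros y IH K; apply ltS; apply ltS in K; destruct K as [K| ->]; auto.
Qed.

Lemma lt_add x d : x < x + d + 1.
Proof.
  ind d; [apply ltS; right; ring|].
  intros d IH; apply ltS; left; rewrite <- addA in IH; exact IH.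
Qed.

Lemma lt_iff x y : x < y <-> exists d, y = x + d + 1.
Proof.
  split; [|intros [d ->]; apply lt_add].
  intro H; cut (exists d, d < y /\ y = x + d + 1); [intros [d [_ K]]; eauto|].
  revert H; ind y; [intro K; destruct (nlt0 _ K)|].
  intros y IH K; apply ltS in K; destruct K as [K| ->].
  - destruct (IH K) as [d [Hd ->]]; exists (d + 1); split; [apply lt_succ_succ, Hd|ring].
  - exists 0; split; [|ring].
    replace (y + 1) with (0 + y + 1) by ring; apply lt_add.
Qed.

Lemma le_iff x y : x <= y <-> exists d, y = x + d.
Proof.
  rewrite <- ltS, lt_iff; split; intros [d H]; exists d; [apply succ_inj|]; rewrite H; ring.
Qed.

Lemma le_refl x : x <= x.
Proof. right; reflexivity. Qed.

Lemma le0 x : 0 <= x.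
Proof. apply le_iff; exists x; ring. Qed.

Lemma le_lt_trans x y z : x <= y -> y < z -> x < z.
Proof. intros [H| ->] K; [exact (lt_trans _ _ _ H K)|exact K]. Qed.

Lemma lt_le_trans x y z : x < y -> y <= z -> x < z.
Proof. intros H [K| <-]; [exact (lt_trans _ _ _ H K)|exact H]. Qed.

Lemma le_trans x y z : x <= y -> y <= z -> x <= z.
Proof. intros H K; apply ltS; apply le_lt_trans with y; [exact H|apply ltS, K]. Qed.

Lemma lt_or_ge x y : x < y \/ y <= x.
Proof.
  ind x; [destruct (le0 y) as [H|H]; auto|].
  intros x [H|H].
  - apply lt_iff in H; destruct H as [d ->].
    destruct (zero_or_succ d) as [->|[e ->]]; [right; right; ring|].
    left; apply lt_iff; exists e; ring.
  - right; left; apply ltS, H.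
Qed.

Lemma not_lt x y : ~ x < y -> y <= x.
Proof. destruct (lt_or_ge x y); tauto. Qed.

Lemma lt_not_ge x y : x < y -> ~ y <= x.
Proof. intros H K; exact (lt_irrefl _ (lt_le_trans _ _ _ H K)). Qed.

Lemma le_antisym x y : x <= y -> y <= x -> x = y.
Proof. intros [H|H] K; [destruct (lt_not_ge _ _ H K)|exact H]. Qed.

Lemma lt_succ_le x y : x < y <-> x + 1 <= y.
Proof.
  rewrite <- ltS; split; [apply lt_succ_succ|].
  intro H; apply ltS in H; apply lt_le_trans with (x + 1); [apply ltS, le_refl|exact H].
Qed.

Lemma add_cancel x y z : x + z = y + z -> x = y.
Proof.
  ind z; [rewrite !add0r; auto|].
  intros z IH H; apply IH, succ_inj; rewrite <- !addrS; exact H.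
Qed.

Lemma le_addr x y : x <= x + y.
Proof. apply le_iff; exists y; reflexivity. Qed.

Lemma le_addl x y : x <= y + x.
Proof. rewrite addC; apply le_addr. Qed.

Lemma lt_add2r x y z : x + z < y + z <-> x < y.
Proof.
  rewrite !lt_iff; split; intros [d H]; exists d; [|rewrite H; ring].
  apply (add_cancel _ _ z); rewrite H; ring.
Qed.

Lemma le_add2r x y z : x + z <= y + z <-> x <= y.
Proof.
  rewrite !le_iff; split; intros [d H]; exists d; [|rewrite H; ring].
  apply (add_cancel _ _ z); rewrite H; ring.
Qed.

Lemma div_mod_unique b q r q' r' : r < b -> r' < b ->
  q * b + r = q' * b + r' -> q = q' /\ r = r'.
Proof.
  (* One remainder below [b] already bounds the other quotient: a larger [q'] would add at least
     [b], which exceeds [r]. *)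
  assert (A : forall q r q' r', r < b -> q * b + r = q' * b + r' -> q' <= q).
  { clear q r q' r'; intros q r q' r' H E; apply not_lt; intro K.
    apply lt_iff in K; destruct K as [d ->].
    apply (lt_not_ge (q * b + r) ((q + d + 1) * b + r')).
    - apply lt_le_trans with (q * b + b).
      + rewrite !(addC (q * b)); apply lt_add2r, H.
      + apply le_iff; exists (d * b + r'); ring.
    - right; symmetry; exact E. }
  intros H H' E.
  assert (q = q') as <- by (apply le_antisym; eauto).
  split; [reflexivity|]; apply (add_cancel _ _ (q * b)); rewrite !(addC _ (q * b)); exact E.
Qed.

(** Strong induction, obtained by ordinary induction on a strict bound for the elements of [P]. *)
Lemma min_exists (P : num M -> Prop) x :
  delta0 (v := v) (w := w) 1 (fun e => P (snd e)) -> P x ->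
  exists y, P y /\ forall z, z < y -> ~ P z.
Proof.
  intros D H; apply NNPP; intro N.
  assert (K : forall x y, y < x -> ~ P y).
  { clear x H; intro x; ind x; [intros y K; destruct (nlt0 _ K)|].
    intros x IH y K Py; apply N; exists y; split; [exact Py|].
    intros z Hz; apply IH; apply ltS in K; exact (lt_le_trans _ _ _ Hz K). }
  exact (K (x + 1) x (proj2 (ltS _ _) (le_refl x)) H).
Qed.

(** Without a greatest element, [P] would have elements above every [n], by induction on [n]; the
    value [b + 1] contradicts the bound. *)
Lemma max_exists (P : num M -> Prop) b x :
  delta0 (v := v) (w := w) 1 (fun e => P (snd e)) -> P x ->
  (forall y, P y -> y <= b) ->
  exists y, P y /\ forall z, P z -> z <= y.
Proof.
  intros D H B; apply NNPP; intro N.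
  assert (K : forall n, exists y, y < b + 1 /\ P y /\ n <= y).
  { intro n; ind n; [exists x; split; [apply ltS, B, H|split; [exact H|apply le0]]|].
    intros n [y [_ [Hy Ky]]]; apply NNPP; intro L; apply N; exists y; split; [exact Hy|].
    intros z Hz; apply not_lt; intro Hyz; apply L; exists z; split; [apply ltS, B, Hz|].
    split; [exact Hz|apply lt_succ_le; exact (le_lt_trans _ _ _ Ky Hyz)]. }
  destruct (K (b + 1)) as [y [Hy [_ Ky]]]; exact (lt_not_ge _ _ Hy Ky).
Qed.

Definition pr x y : num M := (x + y) * (x + y) + x.

(** As [x] is at most the sum [x + y], the code lies between the square of the sum and the next
    square. It therefore determines the sum, and then [x]. *)
Lemma pr_inj x y x' y' : pr x y = pr x' y' -> x = x' /\ y = y'.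
Proof.
  assert (A : forall x y x' y', pr x y = pr x' y' -> x + y <= x' + y').
  { clear x y x' y'; intros x y x' y' E; apply not_lt; intro K.
    apply lt_iff in K; destruct K as [d K].
    apply (lt_irrefl (pr x' y')); rewrite <- E at 2; apply lt_iff.
    (* This is [pr x y] minus [pr x' y'] minus one, expanded with [x + y = x' + y' + d + 1] so that
       no subtraction remains. *)
    exists (x' * (d + d + 1) + y' * (d + d + 1 + 1) + d * d + d + d + x).
    unfold pr; rewrite K; ring. }
  intro E; assert (S : x + y = x' + y') by (apply le_antisym; apply A; auto).
  assert (X : x = x').
  { unfold pr in E; rewrite S in E; apply (add_cancel _ _ ((x' + y') * (x' + y'))).
    rewrite !(addC _ (_ * _)); exact E. }
  split; [exact X|]; subst x'; apply (add_cancel _ _ x); rewrite !(addC _ x); exact S.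
Qed.

Lemma pr_eq3 x y z x' y' z' :
  pr (pr x y) z = pr (pr x' y') z' -> x = x' /\ y = y' /\ z = z'.
Proof.
  intro E; apply pr_inj in E; destruct E as [E ->]; apply pr_inj in E; tauto.
Qed.

(** * Meaning of the statements in a model *)

Implicit Types f C E G H : sets M.

Definition ap G x y : Prop := pr x y \in G.

Definition func G (A B : num M -> Prop) : Prop :=
  (forall z, z \in G -> exists x y, z = pr x y /\ A x /\ B y) /\
  (forall x, A x -> exists y, ap G x y /\ forall y', ap G x y' -> y' = y).

Definition interval_pairs a R z : Prop :=
  exists n m, z = pr n m /\ a <= n /\ n < m /\ m <= R.

Definition enum E l H : Prop :=
  func E (fun x => x < l) (fun x => x \in H) /\
  (forall x, x \in H -> exists i, ap E i x) /\
  (forall i j x y, i < j -> ap E i x -> ap E j y -> x < y).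

Definition minimum H x : Prop := x \in H /\ forall y, y \in H -> x <= y.

Definition weak_homogeneous C H : Prop :=
  exists E l, enum E l H /\
    forall i x y z, ap E i x -> ap E (i + 1) y -> ap E (i + 1 + 1) z ->
      exists k, ap C (pr x y) k /\ ap C (pr y z) k.

Definition large_homogeneous f C a R : Prop :=
  exists H, (forall x, x \in H -> a <= x /\ x <= R) /\ weak_homogeneous C H /\
    exists x u l, minimum H x /\ ap f x u /\ (exists E, enum E l H) /\ u < l.

Definition wph_at f c a R : Prop :=
  forall C, func C (interval_pairs a R) (fun x => x < c) -> large_homogeneous f C a R.

Definition indices D c z : Prop := exists i k, z = pr i k /\ i <= D /\ k < c.

Definition norm G c i u : Prop :=
  (c = 0 /\ u = 0) \/
  ((exists k, k < c /\ ap G (pr i k) u) /\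
   (forall k u', k < c -> ap G (pr i k) u' -> u' <= u)).

Definition mdl_at f c a D : Prop :=
  forall G, func G (indices D c) (fun _ => True) ->
  (forall i, i <= D -> exists u u', norm G c i u /\ ap f (a + i) u' /\ u < u') ->
  exists i j, i < j /\ j <= D /\
    forall k, k < c -> exists u u', ap G (pr i k) u /\ ap G (pr j k) u' /\ u <= u'.

Lemma func_dom G A B x y : func G A B -> ap G x y -> A x /\ B y.
Proof.
  intros [F _] K; destruct (F _ K) as [x' [y' [E K']]].
  apply pr_inj in E; destruct E as [-> ->]; exact K'.
Qed.

Lemma func_unique G A B x y y' : func G A B -> ap G x y -> ap G x y' -> y = y'.
Proof.
  intros F K K'; destruct (func_dom _ _ _ _ _ F K) as [Hx _].
  destruct (proj2 F x Hx) as [y0 [_ U]]; rewrite (U _ K), (U _ K'); reflexivity.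
Qed.

Lemma func_total G (A B : num M -> Prop) x : func G A B -> A x -> exists y, ap G x y.
Proof. intros F K; destruct (proj2 F x K) as [y [Hy _]]; eauto. Qed.

Lemma coloring_range C a R c x y k :
  func C (interval_pairs a R) (fun x => x < c) -> ap C (pr x y) k ->
  a <= x /\ x < y /\ y <= R /\ k < c.
Proof.
  intros F K; destruct (func_dom _ _ _ _ _ F K) as [[n [m [E I]]] Hk].
  apply pr_inj in E; destruct E as [-> ->]; tauto.
Qed.

(* The members of [H] are bounded to keep the induction formula bounded. *)
Lemma enum_length_le E E' l l' H b :
  (forall x, x \in H -> x < b) -> enum E l H -> enum E' l' H -> l' <= l.
Proof.
  intros Hb [F [S I]] [F' [_ I']]; apply not_lt; intro L.
  (* The [t]-th element in the order of [E'] has an index [s] of at least [t] in [E]. If [l < l'],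
     taking [t := l] contradicts [s < l]. *)
  assert (K : forall t, t < l' -> exists s, s < l /\ exists x, x < b /\
    ap E' t x /\ ap E s x /\ t <= s).
  { intro t; unfold ap, pr; ind t.
    - intro L0; destruct (func_total _ _ _ _ F' L0) as [x Hx].
      destruct (func_dom _ _ _ _ _ F' Hx) as [_ Hm]; destruct (S _ Hm) as [s Hs].
      destruct (func_dom _ _ _ _ _ F Hs) as [Hs' _].
      exists s; split; [exact Hs'|exists x; split; [apply Hb, Hm|]].
      split; [exact Hx|split; [exact Hs|apply le0]].
    - intros t IH Lt; assert (Lt' : t < t + 1) by (apply ltS, le_refl).
      destruct IH as [s [_ [x [_ [Hx [Hs Ks]]]]]]; [exact (lt_trans _ _ _ Lt' Lt)|].
      destruct (func_total _ _ _ _ F' Lt) as [x' Hx'].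
      destruct (func_dom _ _ _ _ _ F' Hx') as [_ Hm]; destruct (S _ Hm) as [s' Hs'].
      exists s'; split; [exact (proj1 (func_dom _ _ _ _ _ F Hs'))|].
      exists x'; split; [apply Hb, Hm|split; [exact Hx'|split; [exact Hs'|]]].
      assert (X : x < x') by exact (I' _ _ _ _ Lt' Hx Hx').
      apply lt_succ_le; apply le_lt_trans with s; [exact Ks|].
      destruct (lt_or_ge s s') as [?|[Q|Q]]; [assumption| |].
      + destruct (lt_irrefl x); exact (lt_trans _ _ _ X (I _ _ _ _ Q Hs' Hs)).
      + subst s'; rewrite (func_unique _ _ _ _ _ _ F Hs Hs') in X.
        destruct (lt_irrefl _ X). }
  destruct (K l L) as [s [Hs [x [_ [_ [_ Ks]]]]]]; exact (lt_not_ge _ _ Hs Ks).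
Qed.

(** * Chains coded by numbers *)

(** Quotient and remainder are bounded by terms, [B ^ i] being one, so that this is a bounded
    formula. *)
Definition digit B s i x : Prop :=
  x < B /\ exists q, q < s + 1 /\ exists r, r < B ^ i /\ s = (q * B + x) * B ^ i + r.

(* The chain coded by [s] consists of its [l + 1] lowest digits in base [B];
   coding makes the existence of a chain a bounded formula. *)
Definition chain B C s n k l : Prop :=
  digit B s 0 n /\
  forall i, i < l -> exists x, x < B /\ exists y, y < B /\
    digit B s i x /\ digit B s (i + 1) y /\ ap C (pr x y) k.

Definition reach B C n k l : Prop := exists s, s < B ^ (l + 1) /\ chain B C s n k l.

Ltac unfold_all := unfold reach, chain, digit, ap, pr.

(** The bound on the quotient in [digit] is automatic, since [B] and [B ^ i] are positive. *)
Lemma digit_intro B s i x q r :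
  x < B -> r < B ^ i -> s = (q * B + x) * B ^ i + r -> digit B s i x.
Proof.
  intros Hx Hr Hs; split; [exact Hx|exists q; split; [|exists r; auto]].
  apply ltS, le_iff; apply lt_iff in Hx, Hr; destruct Hx as [d Hd], Hr as [e He].
  exists ((q * (x + d) + x) * B ^ i + q * (r + e) + r).
  rewrite Hs, Hd, <- Hd, He; rewrite Hd at 1; ring.
Qed.

Lemma digit_unique B s i x y : digit B s i x -> digit B s i y -> x = y.
Proof.
  intros [Hx [q [_ [r [Hr E]]]]] [Hy [q' [_ [r' [Hr' E']]]]].
  rewrite E in E'; apply div_mod_unique in E'; [|assumption|assumption].
  destruct E' as [E' _]; apply div_mod_unique in E'; tauto.
Qed.

Lemma mul_add_lt b B r x : r < b -> x < B -> r * B + x < b * B.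
Proof.
  rewrite !lt_iff; intros [d ->] [e ->]; exists (d * (x + e + 1) + e); ring.
Qed.

Lemma digit_cons0 B s n : n < B -> digit B (s * B + n) 0 n.
Proof.
  intro Hn; apply digit_intro with s 0; [exact Hn| |]; rewrite exp0; [|ring].
  apply lt_iff; exists 0; ring.
Qed.

(** Multiplication by [B] moves every digit up one place, and the new lowest digit is absorbed into
    the remainder. Prepending a vertex to a chain is thus [s * B + n]. *)
Lemma digit_consS B s n i x : n < B -> digit B s i x -> digit B (s * B + n) (i + 1) x.
Proof.
  intros Hn [Hx [q [_ [r [Hr E]]]]]; apply digit_intro with q (r * B + n); [exact Hx| |].
  - rewrite expS, (mulC B); apply mul_add_lt; assumption.
  - rewrite expS, E; ring.
Qed.

Lemma reach0 B C n k : n < B -> reach B C n k 0.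
Proof.
  intro Hn; exists (0 * B + n); split.
  - rewrite expS, exp0; replace (B * 1) with B by ring.
    replace (0 * B + n) with n by ring; exact Hn.
  - split; [apply digit_cons0, Hn|intros i Hi; destruct (nlt0 _ Hi)].
Qed.

Lemma reach_succ B C n n' k l :
  n < B -> ap C (pr n n') k -> reach B C n' k l -> reach B C n k (l + 1).
Proof.
  intros Hn Hk [s [Hs [D0 Hc]]]; exists (s * B + n); split.
  - rewrite expS, (mulC B); apply mul_add_lt; assumption.
  - split; [apply digit_cons0, Hn|].
    intros i Hi; destruct (zero_or_succ i) as [->|[j ->]].
    + exists n; split; [exact Hn|exists n'; split; [apply D0|]].
      split; [apply digit_cons0, Hn|split; [apply digit_consS; assumption|exact Hk]].
    + apply lt_add2r in Hi; destruct (Hc j Hi) as [x [Hx [y [Hy [Dx [Dy K]]]]]].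
      exists x; split; [exact Hx|exists y; split; [exact Hy|]].
      split; [apply digit_consS; assumption|split; [apply digit_consS; assumption|exact K]].
Qed.

Section Chain.
Context (B a R c : num M) (C : sets M) (HB : B = R + 1).
Context (HC : func C (interval_pairs a R) (fun x => x < c)).
Context (s n k l : num M) (Hs : chain B C s n k l).

(** Every edge raises the vertex by at least one. At [i := l] this bounds the number of edges of a
    chain. *)
Lemma chain_digit i : i <= l -> exists x, x < B /\ digit B s i x /\ n + i <= x.
Proof.
  destruct Hs as [D0 Hc]; unfold digit; ind i.
  - intros _; exists n; split; [apply D0|split; [exact D0|right; ring]].
  - intros i IH Hi; assert (L : i < l) by apply lt_succ_le, Hi.
    destruct IH as [x [_ [Dx Kx]]]; [left; exact L|].
    destruct (Hc i L) as [x' [_ [y [Hy [Dx' [Dy K]]]]]].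
    rewrite <- (digit_unique _ _ _ _ _ Dx Dx') in K.
    apply (coloring_range _ _ _ _ _ _ _ HC) in K.
    exists y; split; [exact Hy|split; [exact Dy|]].
    rewrite addA; apply lt_succ_le; apply le_lt_trans with x; tauto.
Qed.

Lemma chain_digit_lt i j x y : i < j -> j <= l -> digit B s i x -> digit B s j y -> x < y.
Proof.
  (* The claim is restated with a bounded existential digit, which the chain supplies at each step
     of the induction; uniqueness of digits gives it back for [y]. *)
  intros L; revert y; assert (A : i < j -> j <= l -> digit B s i x ->
    exists y, y < B /\ digit B s j y /\ x < y).
  { clear L; destruct Hs as [_ Hc]; unfold digit; ind j.
    - intro L; destruct (nlt0 _ L).
    - intros j IH Lij Lj Dx; assert (L : j < l) by apply lt_succ_le, Lj.
      destruct (Hc j L) as [x' [_ [y [Hy [Dx' [Dy K]]]]]].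
      apply (coloring_range _ _ _ _ _ _ _ HC) in K.
      exists y; split; [exact Hy|split; [exact Dy|]].
      apply ltS in Lij; destruct Lij as [Lij| ->].
      + destruct IH as [y' [_ [Dy' X]]]; [exact Lij|left; exact L|exact Dx|].
        rewrite (digit_unique _ _ _ _ _ Dy' Dx') in X; exact (lt_trans _ _ _ X (proj1 (proj2 K))).
      + rewrite (digit_unique _ _ _ _ _ Dx Dx'); tauto. }
  intros y Lj Dx Dy; destruct (A L Lj Dx) as [y' [_ [Dy' X]]].
  rewrite (digit_unique _ _ _ _ _ Dy Dy'); exact X.
Qed.

Lemma chain_length_lt : l < B.
Proof.
  destruct (chain_digit l (le_refl l)) as [x [Hx [_ K]]].
  apply le_lt_trans with x; [|exact Hx]; apply le_trans with (n + l); [apply le_addl|exact K].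
Qed.

(** The digits at places [0] to [l] form the required set: consecutive ones are joined by color [k],
    and the least is [n]. *)
Lemma chain_large f u : a <= n -> ap f n u -> u < l + 1 -> large_homogeneous f C a R.
Proof.
  intros Ha Hu Hul; pose proof (proj1 Hs) as D0.
  destruct (delta0_comprehension HM
    (fun x => exists i, i < l + 1 /\ digit B s i x)) as [H HH]; [unfold_all; delta0|].
  destruct (delta0_comprehension HM
    (fun z => exists i, i < l + 1 /\ exists x, x < B /\ z = pr i x /\ digit B s i x))
    as [E HE]; [unfold_all; delta0|].
  assert (EE : forall i x, ap E i x <-> i <= l /\ digit B s i x).
  { intros i x; unfold ap; rewrite HE; split.
    - intros [i' [Hi [x' [_ [Q D]]]]]; apply pr_inj in Q; destruct Q as [-> ->].
      split; [apply ltS, Hi|exact D].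
    - intros [Hi D]; exists i; split; [apply ltS, Hi|].
      exists x; split; [apply D|auto]. }
  assert (HE' : enum E (l + 1) H).
  { split; [split|split].
    - intros z Hz; apply HE in Hz; destruct Hz as [i [Hi [x [_ [-> D]]]]].
      exists i, x; split; [reflexivity|split; [exact Hi|apply HH; eauto]].
    - intros i Hi; apply ltS in Hi; destruct (chain_digit i Hi) as [x [_ [D _]]].
      exists x; split; [apply EE; auto|].
      intros y Hy; apply EE in Hy; apply (digit_unique _ _ _ _ _ (proj2 Hy) D).
    - intros x Hx; apply HH in Hx; destruct Hx as [i [Hi D]]; exists i.
      apply EE; split; [apply ltS, Hi|exact D].
    - intros i j x y L Hx Hy; apply EE in Hx, Hy.
      apply (chain_digit_lt i j); tauto. }
  assert (Hn : forall x, x \in H -> n <= x /\ x <= R).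
  { intros x Hx; apply HH in Hx; destruct Hx as [i [Hi D]]; apply ltS in Hi.
    destruct (chain_digit i Hi) as [x' [Hx' [D' K]]].
    rewrite (digit_unique _ _ _ _ _ D D'); split.
    - apply le_trans with (n + i); [apply le_addr|exact K].
    - apply ltS; rewrite <- HB; exact Hx'. }
  exists H; split; [|split].
  - intros x Hx; destruct (Hn x Hx) as [K1 K2]; split; [exact (le_trans _ _ _ Ha K1)|exact K2].
  - exists E, (l + 1); split; [exact HE'|].
    intros i x y z Hx Hy Hz; exists k; apply EE in Hx, Hy, Hz.
    destruct Hx as [_ Dx], Hy as [Li Dy], Hz as [Lj Dz]; apply lt_succ_le in Li, Lj.
    destruct (proj2 Hs i Li) as [x1 [_ [y1 [_ [Dx1 [Dy1 K]]]]]].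
    destruct (proj2 Hs (i + 1) Lj) as [y2 [_ [z2 [_ [Dy2 [Dz2 K2]]]]]].
    rewrite (digit_unique _ _ _ _ _ Dx Dx1), (digit_unique _ _ _ _ _ Dz Dz2).
    split; [rewrite (digit_unique _ _ _ _ _ Dy Dy1)|rewrite (digit_unique _ _ _ _ _ Dy Dy2)];
      assumption.
  - exists n, u, (l + 1); split; [split|split; [exact Hu|split; [exists E; exact HE'|exact Hul]]].
    + apply HH; exists 0; split; [apply ltS, le0|exact D0].
    + intros y Hy; apply Hn, Hy.
Qed.

End Chain.

(** * The two directions *)

(* The [k]-th entry of the [i]-th tuple is the greatest number of edges of a
   chain of color [k] starting at [a + i]. *)
Lemma mdl_at_wph_at f c a D :
  func f (fun _ => True) (fun _ => True) -> mdl_at f c a D -> wph_at f c a (a + D).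
Proof.
  intros Hf HMDL C HC; apply NNPP; intro N.
  remember (a + D + 1) as B eqn:HB.
  assert (HiB : forall i, i <= D -> a + i < B).
  { intros i Hi; rewrite HB; apply ltS; rewrite !(addC a); apply le_add2r, Hi. }
  (* A chain with [l >= u] edges would have more than [u] elements and be the set excluded by
     [N]. *)
  assert (HR : forall i k l u, i <= D -> reach B C (a + i) k l -> ap f (a + i) u -> l < u).
  { intros i k l u Hi [s [_ Hs]] Hu; apply lt_succ_le, not_lt; intro L; apply N.
    apply (chain_large B a (a + D) c C HB HC s (a + i) k l Hs f u); auto.
    apply le_addr. }
  assert (Hmax : forall i k, i <= D -> exists l, reach B C (a + i) k l /\
    forall l', reach B C (a + i) k l' -> l' <= l).
  { intros i k Hi; apply max_exists with B 0; [unfold_all; delta0|apply reach0, HiB, Hi|].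
    intros l [s [_ Hs]]; left; apply (chain_length_lt B a (a + D) c C HC _ _ _ _ Hs). }
  (* Maximality is tested only against [l' < B]. This keeps the formula bounded and loses nothing,
     because all chains are shorter than [B]; [EG] removes the restriction. *)
  destruct (delta0_comprehension HM (fun z => exists i, i < D + 1 /\ exists k, k < c /\
    exists l, l < B /\ z = pr (pr i k) l /\ reach B C (a + i) k l /\
      forall l', l' < B -> reach B C (a + i) k l' -> l' <= l)) as [G HG];
    [unfold_all; delta0|].
  assert (HlB : forall n k l, reach B C n k l -> l < B).
  { intros n k l [s [_ Hs]]; apply (chain_length_lt B a (a + D) c C HC _ _ _ _ Hs). }
  assert (EG : forall i k l, ap G (pr i k) l <-> i <= D /\ k < c /\ reach B C (a + i) k l /\
    forall l', reach B C (a + i) k l' -> l' <= l).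
  { intros i k l; unfold ap; rewrite HG; split.
    - intros [i' [Hi [k' [Hk [l' [Hl [Q [K1 K2]]]]]]]].
      apply pr_eq3 in Q; destruct Q as [-> [-> ->]].
      split; [apply ltS, Hi|split; [exact Hk|split; [exact K1|]]]; eauto.
    - intros [Hi [Hk [K1 K2]]]; exists i; split; [apply ltS, Hi|].
      exists k; split; [exact Hk|exists l; split; [eauto|auto]]. }
  destruct (HMDL G) as [i [j [Hij [Hj K]]]].
  - split.
    + intros z Hz; apply HG in Hz.
      destruct Hz as [i [Hi [k [Hk [l [_ [-> _]]]]]]]; exists (pr i k), l.
      split; [reflexivity|split; [|exact I]]; exists i, k; rewrite <- ltS; auto.
    + intros z [i [k [-> [Hi Hk]]]]; destruct (Hmax i k Hi) as [l Hl].
      exists l; split; [apply EG; tauto|].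
      intros l' Hl'; apply EG in Hl'; apply le_antisym; [apply Hl|]; apply Hl'; tauto.
  - intros i Hi; destruct (func_total _ _ _ (a + i) Hf I) as [u Hu].
    destruct (zero_or_succ c) as [Hc|[c' Hc]].
    (* Without colors the norm is [0] by convention. That [u] is positive follows from the chain
       with no edges, which exists for any [k]. *)
    + exists 0, u; split; [left; auto|split; [exact Hu|]].
      apply (HR i 0 0 u Hi); [apply reach0, HiB, Hi|exact Hu].
    + destruct (Hmax i 0 Hi) as [l0 Hl0].
      destruct (max_exists (fun l => exists k, k < c /\ ap G (pr i k) l) B l0)
        as [l [[k [Hk Hl]] Kl]].
      * unfold_all; delta0.
      * assert (0 < c) by (rewrite Hc; apply ltS, le0).
        exists 0; split; [|apply EG]; tauto.
      * intros l [k [_ Hl]]; apply EG in Hl; left; apply (HlB (a + i) k); tauto.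
      * exists l, u; split; [right; split; [eauto|]|split; [exact Hu|]].
        -- intros k' l' Hk' Hl'; apply Kl; eauto.
        -- apply EG in Hl; apply (HR i k); tauto.
  - assert (P : interval_pairs a (a + D) (pr (a + i) (a + j))).
    { exists (a + i), (a + j); split; [reflexivity|split; [apply le_addr|]].
      rewrite !(addC a); rewrite lt_add2r, le_add2r; auto. }
    destruct (func_total _ _ _ _ HC P) as [k Hk].
    pose proof (coloring_range _ _ _ _ _ _ _ HC Hk) as [_ [_ [_ Hkc]]].
    destruct (K k Hkc) as [u [u' [Hu [Hu' L]]]]; apply EG in Hu, Hu'.
    (* Prepending [a + i] to a longest chain from [a + j] gives [u' + 1 <= u], against [u <= u']. *)
    apply (lt_not_ge u' (u' + 1)); [apply ltS, le_refl|].
    apply le_trans with u; [|exact L].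
    apply Hu, reach_succ with (a + j); [apply HiB; tauto|exact Hk|apply Hu'].
Qed.

(* Two tuples are joined by the color of the least coordinate that decreases
   strictly; the entry of that coordinate decreases along a chain. *)
Lemma wph_at_mdl_at f c a D :
  func f (fun _ => True) (fun _ => True) -> wph_at f c a (a + D) -> mdl_at f c a D.
Proof.
  intros Hf HW G HG Hnorm; apply NNPP; intro N.
  assert (TG : forall i k, i <= D -> k < c -> exists u, ap G (pr i k) u).
  { intros i k Hi Hk; apply (func_total _ _ _ _ HG); exists i, k; auto. }
  assert (UG : forall i k u u', ap G (pr i k) u -> ap G (pr i k) u' -> u = u').
  { intros i k u u'; apply (func_unique _ _ _ _ _ _ HG). }
  (* [L] holds the triples for which coordinate [k] decreases from tuple [i] to tuple [j]. In both
     forms [t] bounds the two entries; they are equivalent because the entries exist and are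
     unique. *)
  destruct (delta1_comprehension HM
    (fun z t => exists i, i < D + 1 /\ exists j, j < D + 1 /\ exists k, k < c /\
      z = pr (pr i j) k /\ exists u, u < t /\ exists u', u' < t /\
        ap G (pr i k) u /\ ap G (pr j k) u' /\ u' < u)
    (fun z t => exists i, i < D + 1 /\ exists j, j < D + 1 /\ exists k, k < c /\
      z = pr (pr i j) k /\ forall u, u < t -> forall u', u' < t ->
        ap G (pr i k) u -> ap G (pr j k) u' -> u' < u)) as [L HL].
  { unfold_all; delta0. }
  { unfold_all; delta0. }
  { intro z; split.
    - intros [t0 [i [Hi [j [Hj [k [Hk [-> [u [_ [u' [_ [Hu [Hu' Q]]]]]]]]]]]]]] t.
      exists i; split; [exact Hi|exists j; split; [exact Hj|exists k; split; [exact Hk|]]].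
      split; [reflexivity|intros u1 _ u1' _ Hu1 Hu1'].
      rewrite (UG _ _ _ _ Hu1 Hu), (UG _ _ _ _ Hu1' Hu'); exact Q.
    (* Any [t] serves to decode [z]; the entries found afterwards determine the [t] at which the
       comparison is read off. *)
    - intro K; destruct (K 0) as [i [Hi [j [Hj [k [Hk [-> _]]]]]]].
      destruct (TG i k) as [u Hu]; [apply ltS, Hi|exact Hk|].
      destruct (TG j k) as [u' Hu']; [apply ltS, Hj|exact Hk|].
      assert (Lu : u < u + u' + 1) by apply lt_add.
      assert (Lu' : u' < u + u' + 1) by (rewrite (addC u); apply lt_add).
      destruct (K (u + u' + 1)) as [i1 [_ [j1 [_ [k1 [_ [Q K1]]]]]]].
      apply pr_eq3 in Q; destruct Q as [<- [<- <-]].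
      exists (u + u' + 1), i; split; [exact Hi|exists j; split; [exact Hj|]].
      exists k; split; [exact Hk|split; [reflexivity|]].
      exists u; split; [exact Lu|exists u'; split; [exact Lu'|auto]]. }
  assert (EL : forall i j k, pr (pr i j) k \in L <-> i <= D /\ j <= D /\ k < c /\
    exists u u', ap G (pr i k) u /\ ap G (pr j k) u' /\ u' < u).
  { intros i j k; rewrite HL; split.
    - intros [t [i' [Hi [j' [Hj [k' [Hk [Q [u [_ [u' [_ K]]]]]]]]]]]].
      apply pr_eq3 in Q; destruct Q as [-> [-> ->]]; rewrite <- !ltS; eauto 7.
    - intros [Hi [Hj [Hk [u [u' K]]]]]; apply ltS in Hi, Hj.
      exists (u + u' + 1), i; split; [exact Hi|exists j; split; [exact Hj|]].
      exists k; split; [exact Hk|split; [reflexivity|]].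
      exists u; split; [apply lt_add|exists u'; split; [|exact K]].
      rewrite (addC u); apply lt_add. }
  destruct (delta0_comprehension HM (fun z => exists i, i < D + 1 /\ exists j, j < D + 1 /\
    exists k, k < c /\ z = pr (pr (a + i) (a + j)) k /\ i < j /\ pr (pr i j) k \in L /\
      forall k', k' < k -> ~ pr (pr i j) k' \in L)) as [C HC];
    [unfold_all; delta0|].
  assert (EC : forall i j k, ap C (pr (a + i) (a + j)) k -> i < j /\ j <= D /\ k < c /\
    pr (pr i j) k \in L /\ forall k', k' < k -> ~ pr (pr i j) k' \in L).
  { intros i j k K; apply HC in K; destruct K as [i' [_ [j' [Hj [k' [Hk [Q K]]]]]]].
    apply pr_eq3 in Q; destruct Q as [Qi [Qj ->]].
    rewrite !(addC a) in Qi, Qj; apply add_cancel in Qi, Qj; subst i' j'.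
    rewrite <- ltS; tauto. }
  assert (FC : func C (interval_pairs a (a + D)) (fun x => x < c)).
  { split.
    - intros z Hz; apply HC in Hz; destruct Hz as [i [Hi [j [Hj [k [Hk [-> [Hij _]]]]]]]].
      exists (pr (a + i) (a + j)), k; split; [reflexivity|split; [|exact Hk]].
      exists (a + i), (a + j); split; [reflexivity|split; [apply le_addr|]].
      rewrite !(addC a), lt_add2r, le_add2r, <- ltS; auto.
    - intros z [n [m [-> [Hn [Hnm Hm]]]]].
      apply le_iff in Hn; destruct Hn as [i ->].
      apply lt_iff in Hnm; destruct Hnm as [d ->].
      replace (a + i + d + 1) with (a + (i + d + 1)) in * by ring.
      remember (i + d + 1) as j eqn:Hj.
      assert (Hij : i < j) by (rewrite Hj; apply lt_add).
      rewrite !(addC a), le_add2r in Hm.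
      assert (Hi : i <= D) by (left; exact (lt_le_trans _ _ _ Hij Hm)).
      (* If no coordinate decreased, [i < j] would be the pair that [N] excludes. *)
      destruct (classic (exists k, pr (pr i j) k \in L)) as [[k0 K0]|K0].
      + destruct (min_exists (fun k => pr (pr i j) k \in L) k0) as [k [Hk Mk]];
          [unfold_all; delta0|exact K0|].
        exists k; split.
        * apply HC; apply ltS in Hi, Hm; exists i; split; [exact Hi|].
          exists j; split; [exact Hm|exists k; split; [apply EL in Hk; tauto|auto]].
        * intros k' Hk'; apply EC in Hk'; apply le_antisym; apply not_lt; intro Q.
          -- apply (proj2 (proj2 (proj2 (proj2 Hk'))) k Q Hk).
          -- apply (Mk k' Q); tauto.
      + exfalso; apply N; exists i, j; split; [exact Hij|split; [exact Hm|]].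
        intros k Hk; destruct (TG i k Hi Hk) as [u Hu], (TG j k Hm Hk) as [u' Hu'].
        exists u, u'; split; [exact Hu|split; [exact Hu'|]].
        apply not_lt; intro Q; apply K0; exists k; apply EL; eauto 8. }
  destruct (HW C FC) as [H [HH [[E [l [HE HWH]]] [x [u [l' [[Hx Mx] [Hu [[E' HE'] Hul]]]]]]]]].
  assert (Hb : forall y, y \in H -> y < a + D + 1) by (intros y Hy; apply ltS, HH, Hy).
  (* Homogeneity and cardinality come with separate enumerations; the size bound is carried over to
     the one that witnesses homogeneity. *)
  assert (Hl : u < l) by exact (lt_le_trans _ _ _ Hul (enum_length_le _ _ _ _ _ _ Hb HE HE')).
  clear E' HE' l' Hul; destruct HE as [FE [SE IE]].
  assert (L0 : 0 < l) by exact (le_lt_trans _ _ _ (le0 u) Hl).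
  (* The chain must start at the minimum, since [f] is evaluated there and the norm of that tuple
     has to bound the descent. *)
  assert (Hx0 : ap E 0 x).
  { destruct (func_total _ _ _ _ FE L0) as [h Hh], (SE x Hx) as [t Ht].
    destruct (zero_or_succ t) as [->|[t' ->]]; [exact Ht|].
    assert (K : h < x) by (apply (IE 0 (t' + 1)); auto; apply ltS, le0).
    destruct (lt_not_ge _ _ K); apply Mx, (func_dom _ _ _ _ _ FE Hh). }
  assert (HD : forall t y, ap E t y -> exists i, i <= D /\ y = a + i).
  { intros t y Hy; destruct (HH y) as [K1 K2]; [apply (func_dom _ _ _ _ _ FE Hy)|].
    apply le_iff in K1; destruct K1 as [i ->]; exists i; split; [|reflexivity].
    rewrite !(addC a), le_add2r in K2; exact K2. }
  destruct (HD 0 x Hx0) as [i0 [Hi0 ->]].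
  destruct (Hnorm i0 Hi0) as [m [u0 [Hm [Hu0 Lm]]]].
  rewrite <- (func_unique _ _ _ _ _ _ Hf Hu Hu0) in Lm; clear Hu0 u0.
  (* From [m < u < l] there are at least two elements, so a first edge exists; its color [k] is the
     color of all edges. *)
  assert (L1 : 0 + 1 < l).
  { apply le_lt_trans with u; [|exact Hl]; apply lt_succ_le.
    exact (le_lt_trans _ _ _ (le0 m) Lm). }
  destruct (func_total _ _ _ _ FE L1) as [h1 Hh1].
  assert (EP : forall t y z, ap E t y -> ap E (t + 1) z ->
    exists k, ap C (pr y z) k).
  { intros t y z Hy Hz; apply (func_total _ _ _ _ FC).
    exists y, z; split; [reflexivity|split; [|split]].
    - apply HH, (func_dom _ _ _ _ _ FE Hy).
    - apply (IE t (t + 1)); auto; apply ltS, le_refl.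
    - apply HH, (func_dom _ _ _ _ _ FE Hz). }
  destruct (EP _ _ _ Hx0 Hh1) as [k Hk].
  pose proof (coloring_range _ _ _ _ _ _ _ FC Hk) as [_ [_ [_ Hkc]]].
  assert (Hcol : forall t, t + 1 < l -> exists y, y < a + D + 1 /\ exists z, z < a + D + 1 /\
    ap E t y /\ ap E (t + 1) z /\ ap C (pr y z) k).
  { intro t; unfold ap, pr; ind t.
    - intros _; exists (a + i0); split; [apply Hb, Hx|].
      exists h1; split; [apply Hb, (func_dom _ _ _ _ _ FE Hh1)|].
      split; [exact Hx0|split; [exact Hh1|exact Hk]].
    - intros t IH Lt.
      destruct IH as [y [_ [z [Hz [Ey [Ez K]]]]]];
        [apply lt_trans with (t + 1 + 1); [apply ltS, le_refl|exact Lt]|].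
      destruct (func_total _ _ _ _ FE Lt) as [z' Ez'].
      destruct (HWH t y z z' Ey Ez Ez') as [k' [K1 K2]].
      rewrite (func_unique _ _ _ _ _ _ FC K1 K) in K2.
      exists z; split; [exact Hz|exists z'; split;
        [apply Hb, (func_dom _ _ _ _ _ FE Ez')|split; [exact Ez|split; [exact Ez'|exact K2]]]]. }
  destruct (TG i0 k Hi0 Hkc) as [g0 Hg0].
  (* Each edge of color [k] lowers the [k]-th entry by at least one; the sum [g + t] records this
     without subtraction. *)
  assert (Hdesc : forall t, t < l -> exists i, i < D + 1 /\ ap E t (a + i) /\
    exists g, g < g0 + 1 /\ ap G (pr i k) g /\ g + t <= g0).
  { intro t; unfold ap, pr; ind t.
    - intros _; exists i0; split; [apply ltS, Hi0|split; [exact Hx0|]].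
      exists g0; split; [apply ltS, le_refl|split; [exact Hg0|right; ring]].
    - intros t IH Lt.
      destruct IH as [i [Hi [Ei [g [_ [Hg Kg]]]]]];
        [apply lt_trans with (t + 1); [apply ltS, le_refl|exact Lt]|].
      destruct (Hcol t Lt) as [y [_ [z [_ [Ey [Ez K]]]]]].
      rewrite (func_unique _ _ _ _ _ _ FE Ey Ei) in K.
      destruct (HD _ _ Ez) as [j [Hj ->]].
      apply EC in K; destruct K as [_ [_ [_ [K _]]]]; apply EL in K.
      destruct K as [_ [_ [_ [g1 [g' [Hg1 [Hg' L']]]]]]].
      rewrite (UG _ _ _ _ Hg1 Hg) in L'.
      assert (Kg' : g' + (t + 1) <= g0).
      { apply le_trans with (g + t); [|exact Kg].
        replace (g' + (t + 1)) with (g' + 1 + t) by ring.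
        apply le_add2r, lt_succ_le, L'. }
      exists j; split; [apply ltS, Hj|split; [exact Ez|exists g'; split; [|split; assumption]]].
      apply ltS; apply le_trans with (g' + (t + 1)); [apply le_addr|exact Kg']. }
  destruct (zero_or_succ l) as [->|[t ->]]; [exact (lt_irrefl _ L0)|].
  destruct (Hdesc t) as [i [_ [_ [g [_ [_ Kg]]]]]]; [apply ltS, le_refl|].
  assert (Km : g0 <= m).
  { destruct Hm as [[-> _]|[_ Hm]]; [destruct (nlt0 _ Hkc)|exact (Hm k g0 Hkc Hg0)]. }
  (* At the last index [t], where [l = t + 1], one gets [u <= t <= g + t <= g0 <= m], against
     [m < u]. *)
  apply (lt_not_ge m u Lm); apply ltS in Hl.
  apply le_trans with t; [exact Hl|].
  apply le_trans with (g + t); [apply le_addl|exact (le_trans _ _ _ Kg Km)].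
Qed.

(** For [R < a] the empty set is a coloring, but the empty interval has no nonempty subset. Hence a
    witness [R] can be written as [a + D]. *)
Lemma wph_at_le f c a R : wph_at f c a R -> a <= R.
Proof.
  intro HW; destruct (delta0_comprehension HM (fun x => x < 0)) as [C HC]; [delta0|].
  apply not_lt; intro K.
  destruct (HW C) as [H [HH [_ [x [_ [_ [[Hx _] _]]]]]]].
  - split; [intros z Hz; apply HC in Hz; destruct (nlt0 _ Hz)|].
    intros z [n [m [_ [Hn [Hnm Hm]]]]]; destruct (lt_not_ge _ _ K).
    left; exact (le_lt_trans _ _ _ Hn (lt_le_trans _ _ _ Hnm Hm)).
  - apply (lt_not_ge _ _ K); destruct (HH x Hx); eauto using le_trans.
Qed.

Lemma mdl_iff_wph f c : func f (fun _ => True) (fun _ => True) ->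
  (forall a, exists D, mdl_at f c a D) <-> (forall a, exists R, wph_at f c a R).
Proof.
  intro Hf; split; intros H a; destruct (H a) as [b Hb].
  - exists (a + b); apply mdl_at_wph_at; assumption.
  - pose proof (wph_at_le _ _ _ _ Hb) as L; apply le_iff in L; destruct L as [D ->].
    exists D; apply wph_at_mdl_at; assumption.
Qed.

End Arithmetic.

(** * From the formal sentence to its meaning in a model *)

Section Translation.
Context {M : structure}.
Implicit Types (v : nat -> num M) (w : nat -> sets M).

Lemma translate_allN v w p (P : num M -> Prop) :
  (forall x, sat (scons x v) w p <-> P x) -> sat v w (AllN p) <-> forall x, P x.
Proof. apply Morphisms_Prop.all_iff_morphism. Qed.

Lemma translate_allS v w p (P : sets M -> Prop) :
  (forall X, sat v (scons X w) p <-> P X) -> sat v w (AllS p) <-> forall X, P X.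
Proof. apply Morphisms_Prop.all_iff_morphism. Qed.

Lemma translate_exN v w p (P : num M -> Prop) :
  (forall x, sat (scons x v) w p <-> P x) -> sat v w (ExN p) <-> exists x, P x.
Proof. intro H; rewrite sat_exN; apply Morphisms_Prop.ex_iff_morphism; exact H. Qed.

Lemma translate_exS v w p (P : sets M -> Prop) :
  (forall X, sat v (scons X w) p <-> P X) -> sat v w (ExS p) <-> exists X, P X.
Proof. intro H; rewrite sat_exS; apply Morphisms_Prop.ex_iff_morphism; exact H. Qed.

Lemma translate_imp v w p q (P Q : Prop) :
  (sat v w p <-> P) -> (sat v w q <-> Q) -> sat v w (Imp p q) <-> (P -> Q).
Proof. simpl; tauto. Qed.

Lemma translate_and v w p q (P Q : Prop) :
  (sat v w p <-> P) -> (sat v w q <-> Q) -> sat v w (And p q) <-> P /\ Q.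
Proof. rewrite sat_and; tauto. Qed.

Lemma translate_or v w p q (P Q : Prop) :
  (sat v w p <-> P) -> (sat v w q <-> Q) -> sat v w (Or p q) <-> P \/ Q.
Proof. rewrite sat_or; tauto. Qed.

Lemma translate_iff v w p q (P Q : Prop) :
  (sat v w p <-> P) -> (sat v w q <-> Q) -> sat v w (Iff p q) <-> (P <-> Q).
Proof. rewrite sat_iff; tauto. Qed.

Lemma translate_true v w : sat v w (Not Bot) <-> True.
Proof. simpl; tauto. Qed.

End Translation.

Ltac translate :=
  lazymatch goal with
  | |- sat _ _ (AllN _) <-> _ => apply translate_allN; intro; translate
  | |- sat _ _ (AllS _) <-> _ => apply translate_allS; intro; translate
  | |- sat _ _ (ExN _) <-> _ => apply translate_exN; intro; translate
  | |- sat _ _ (ExS _) <-> _ => apply translate_exS; intro; translate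
  | |- sat _ _ (Imp _ _) <-> _ => apply translate_imp; translate
  | |- sat _ _ (And _ _) <-> _ => apply translate_and; translate
  | |- sat _ _ (Or _ _) <-> _ => apply translate_or; translate
  | |- sat _ _ (Iff _ _) <-> _ => apply translate_iff; translate
  | |- sat _ _ (Not Bot) <-> _ => apply translate_true
  | |- _ => reflexivity
  end.

Lemma sat_corollary18 {M : structure} (v : nat -> num M) (w : nat -> sets M) :
  sat v w (sentence (allS f, function f naturals naturals ->
    allN c, MDL f c <-> WPH f c)%so) <->
  forall f : sets M, func f (fun _ => True) (fun _ => True) ->
  forall c, (forall a, exists D, mdl_at f c a D) <-> (forall a, exists R, wph_at f c a R).
Proof.
  unfold wph_at, mdl_at, large_homogeneous, weak_homogeneous, enum, minimum,
    norm, indices, interval_pairs, func, ap.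
  (* Only the higher-order combinators are unfolded: [And], [Or], [Iff], [ExN] and [ExS] stay folded
     for [translate] to match, and the level arithmetic is left to conversion at the atoms. *)
  cbv beta delta [sentence all_num ex_num all_set ex_set level zero one add mul exp
    eq_num lt_num mem true_ not_ and_ or_ imp_ iff_ pair app function naturals below
    pairs_of_interval enumeration card is_min weakly_homogeneous WPH_at WPH
    sequence_indices max_norm MDL_at MDL].
  translate.
Qed.

Theorem corollary18 :
  proves RCA0star
    (sentence
       (allS f, function f naturals naturals ->
        allN c, MDL f c <-> WPH f c)%so).
Proof.
  apply completeness; [exact RCA0star_subst|].
  intros M v w HA HN HS; apply sat_corollary18; intros f Hf c.
  apply (mdl_iff_wph (Build_named_model M v w HA HN HS)), Hf.
Qed.
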